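(* Let $G=(V,E)$ be a directed graph with $n=|V|$, equipped with non-negative edge lengths $\ell:E\to\mathbb{R}_{\ge 0}$ and non-negative edge delays $d:E\to\mathbb{R}_{\ge 0}$, let $\varepsilon>0$, and let $\pi:E\to\mathbb{N}$ be a frequency function with positive integer values. Let $\pi_{\mathrm{sum}}:=\sum_{e\in E}\pi(e)=O(\mathrm{poly}(n))$ and $\Pi:=\sum_{e\in E}\frac{1}{\pi(e)}$. Let $h\in[1,\pi_{\mathrm{sum}}]$ be an integer, let $0<D_{\min}\le D_{\max}$ be such that $D_{\max}/D_{\min}=\mathrm{poly}(n)$, and let $s\in V$ be a source. Then there is an algorithm which, after $O(h\cdot\Pi\log(n)/\varepsilon)$ preprocessing time, given any $t\in V$ and any $D\in[D_{\min},D_{\max}]$, computes in constant time the value $\ell(P_t)$, where $P_t$ is some $(s,t)$-path in $G$ satisfying (i) $\ell(P_t)\le \mathrm{dist}^{\pi\le h}(s,t,D)$, and (ii) $d(P_t)\le(1+\varepsilon)D$.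
   Context: For a path (or edge set) $P$, $\ell(P)=\sum_{e\in P}\ell(e)$, $d(P)=\sum_{e\in P}d(e)$ and $\pi(P)=\sum_{e\in P}\pi(e)$. For $s,t\in V$ and $x\ge 0$, $\mathrm{dist}^{\pi\le h}(s,t,x)$ denotes the smallest length $\ell(P)$ of an $(s,t)$-path $P$ in $G$ with $\pi(P)\le h$ and $d(P)\le x$ (and $\infty$ if no such path exists). Standing assumption of the paper: $\varepsilon^{-1}=\mathrm{poly}(n)$.
   Formalization: Here ε is bounded by a constant, n ≥ 2, edges with π(e) ≤ h come first in the input list, and the time bound is max(1, h·Π·log(n)/ε), since otherwise the bound can be too small to read the input; if dist is ∞, the answer ∞ is allowed, as no path P_t need exist. *)

(* Defs.v *)
From mathcomp Require Import all_boot all_order all_algebra.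
From mathcomp Require Import classical_sets reals constructive_ereal ereal exp.

Set Implicit Arguments.
Unset Strict Implicit.
Unset Printing Implicit Defensive.

Import Order.TTheory GRing.Theory Num.Theory.
Local Open Scope ring_scope.

(** * Paths, restricted distances *)

Section Paths.
Context {R : realType} {n : nat}.
Notation edge := ('I_n * 'I_n)%type.
Variable E : {set edge}.

(* A path from [s] is given by the list [p] of its vertices after [s]; paths
   are simple, so that a path and its edge set determine each other. *)
Definition is_path (s t : 'I_n) (p : seq 'I_n) : Prop :=
  [/\ path (fun u v => (u, v) \in E) s p, last s p = t & uniq (s :: p)].

(* [zip] drops the extra last vertex of [s :: p]. *)
Definition path_edges (s : 'I_n) (p : seq 'I_n) : seq edge := zip (s :: p) p.

Definition path_weight (w : edge -> R) (s : 'I_n) (p : seq 'I_n) : R :=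
  \sum_(e <- path_edges s p) w e.

Definition path_freq (freq : edge -> nat) (s : 'I_n) (p : seq 'I_n) : nat :=
  (\sum_(e <- path_edges s p) freq e)%N.

(* There are finitely many simple paths, so this infimum is a minimum, or +oo
   when no path qualifies. *)
Definition rdist (ell d : edge -> R) (freq : edge -> nat) (h : nat)
    (s t : 'I_n) (x : R) : \bar R :=
  ereal_inf [set (path_weight ell s p)%:E | p in
    [set p | [/\ is_path s t p, (path_freq freq s p <= h)%N
                & path_weight d s p <= x]]]%classic.

(* If no (s,t)-path meets the two constraints, there need not be any path
   [P_t]; the answer +oo is then allowed. *)
Definition valid_answer (ell d : edge -> R) (freq : edge -> nat) (h : nat)
    (eps : R) (s t : 'I_n) (D : R) (o : \bar R) : Prop :=
  (exists p, [/\ is_path s t p,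
                 o = (path_weight ell s p)%:E,
                 ((path_weight ell s p)%:E <= rdist ell d freq h s t D)%E
               & path_weight d s p <= (1 + eps) * D])
  \/ (o = +oo%E /\ rdist ell d freq h s t D = +oo%E).

Definition pi_sum (freq : edge -> nat) : nat := (\sum_(e in E) freq e)%N.

Definition inv_pi_sum (freq : edge -> nat) : R :=
  \sum_(e in E) (freq e)%:R^-1.

(* [es] lists the edges in an order in which those of frequency at most [h]
   come first.  Any order will do if all frequencies are at most [h], and any
   listing by non-decreasing frequency qualifies. *)
Definition edge_listing (freq : edge -> nat) (h : nat) (es : seq edge) : Prop :=
  perm_eq es (enum E) /\
  sorted (fun e f => (freq f <= h)%N ==> (freq e <= h)%N) es.

End Paths.

(** * Machine model

   A word RAM with real-valued cells.  The memory consists of infinitely many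
   arrays of words and infinitely many arrays of reals; a program mentions only
   finitely many of them, by constant names (equivalently, they are interleaved
   in one memory), whereas indices into an array are computed.  Every word
   produced by an instruction must be smaller than a bound [B]; otherwise the
   execution is stuck and [exec] does not hold.  Reals are exact; they can
   be turned into words only through [Floor], subject to the same bound. *)

Inductive wexp : Type :=
| WConst of nat
| WGet of nat & wexp            (* array name, index *)
| WAdd of wexp & wexp
| WSub of wexp & wexp           (* truncated *)
| WMul of wexp & wexp
| WDiv of wexp & wexp
| WMod of wexp & wexp
| WLog2 of wexp.                (* index of the leading bit *)

Inductive rexp : Type :=
| RofW of wexp
| RGet of nat & wexp
| RAdd of rexp & rexp
| RSub of rexp & rexp
| RMul of rexp & rexp
| RDiv of rexp & rexp.

Inductive cond : Type :=
| CLeW of wexp & wexp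
| CLeR of rexp & rexp
| CNot of cond
| CAnd of cond & cond.

Inductive cmd : Type :=
| Skip
| SetW of nat & wexp & wexp     (* array name, index, value *)
| SetR of nat & wexp & rexp
| Floor of nat & wexp & rexp    (* truncates to a word *)
| Seq of cmd & cmd
| If of cond & cmd & cmd
| While of cond & cmd.

Section Semantics.
Context {R : realType}.

Record store := Store {
  wmem : nat -> nat -> nat;
  rmem : nat -> nat -> R }.

Definition upd {T : Type} (f : nat -> nat -> T) (a i : nat) (x : T) :
    nat -> nat -> T :=
  fun b j => if (b == a) && (j == i) then x else f b j.

Definition setw (st : store) a i k := Store (upd (wmem st) a i k) (rmem st).
Definition setr (st : store) a i x := Store (wmem st) (upd (rmem st) a i x).

Variable B : nat.

Definition fit (k : nat) : option nat := if (k < B)%N then Some k else None.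

Definition lift2 {T U : Type} (f : T -> T -> U) (x y : option T) : option U :=
  if x is Some a then if y is Some b then Some (f a b) else None else None.

Fixpoint evalw (st : store) (e : wexp) : option nat :=
  match e with
  | WConst k => fit k
  | WGet a i => omap (wmem st a) (evalw st i)
  | WAdd x y => obind fit (lift2 addn (evalw st x) (evalw st y))
  | WSub x y => obind fit (lift2 subn (evalw st x) (evalw st y))
  | WMul x y => obind fit (lift2 muln (evalw st x) (evalw st y))
  | WDiv x y => obind fit (lift2 divn (evalw st x) (evalw st y))
  | WMod x y => obind fit (lift2 modn (evalw st x) (evalw st y))
  | WLog2 x => obind fit (omap (trunc_log 2) (evalw st x))
  end.

Fixpoint evalr (st : store) (e : rexp) : option R :=
  match e with
  | RofW x => omap (fun k => k%:R) (evalw st x)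
  | RGet a i => omap (rmem st a) (evalw st i)
  | RAdd x y => lift2 (fun a b => a + b) (evalr st x) (evalr st y)
  | RSub x y => lift2 (fun a b => a - b) (evalr st x) (evalr st y)
  | RMul x y => lift2 (fun a b => a * b) (evalr st x) (evalr st y)
  | RDiv x y => lift2 (fun a b => a / b) (evalr st x) (evalr st y)
  end.

Fixpoint evalc (st : store) (b : cond) : option bool :=
  match b with
  | CLeW x y => lift2 leq (evalw st x) (evalw st y)
  | CLeR x y => lift2 (fun a b : R => a <= b) (evalr st x) (evalr st y)
  | CNot x => omap negb (evalc st x)
  | CAnd x y => lift2 andb (evalc st x) (evalc st y)
  end.

(* [exec c st k st']: from [st], [c] terminates in [st'] after [k] steps.  An
   assignment or a test is one step: the size of the expressions it evaluates
   is a constant of the program. *)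
Inductive exec : cmd -> store -> nat -> store -> Prop :=
| exec_skip st : exec Skip st 1 st
| exec_setw a i e st vi v :
    evalw st i = Some vi -> evalw st e = Some v ->
    exec (SetW a i e) st 1 (setw st a vi v)
| exec_setr a i e st vi v :
    evalw st i = Some vi -> evalr st e = Some v ->
    exec (SetR a i e) st 1 (setr st a vi v)
| exec_floor a i e st vi x v :
    evalw st i = Some vi -> evalr st e = Some x ->
    fit (Num.truncn x) = Some v ->
    exec (Floor a i e) st 1 (setw st a vi v)
| exec_seq c1 c2 st k1 st1 k2 st2 :
    exec c1 st k1 st1 -> exec c2 st1 k2 st2 ->
    exec (Seq c1 c2) st (k1 + k2) st2
| exec_if b c1 c2 st v k st' :
    evalc st b = Some v -> exec (if v then c1 else c2) st k st' ->
    exec (If b c1 c2) st k.+1 st'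
| exec_while_stop b c st :
    evalc st b = Some false -> exec (While b c) st 1 st
| exec_while_loop b c st k1 st1 k2 st2 :
    evalc st b = Some true -> exec c st k1 st1 ->
    exec (While b c) st1 k2 st2 ->
    exec (While b c) st (k1 + k2).+1 st2.

End Semantics.

Arguments store R : clear implicits.

(** * Input and output conventions *)

Section Interface.
Context {R : realType} {n : nat}.
Notation edge := ('I_n * 'I_n)%type.

(* Word arrays: 0 holds n, m, h, s; 1, 2, 3 hold the tail, head and frequency
   of each edge.  Real arrays: 0 holds eps, Dmin, Dmax; 1, 2 hold the length
   and delay of each edge.  All other cells are 0. *)
Definition input_store (ell d : edge -> R) (freq : edge -> nat)
    (es : seq edge) (eps Dmin Dmax : R) (h : nat) (s : 'I_n) : store R :=
  Store
    (fun a i => match a with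
       | 0 => nth 0 [:: n; size es; h; val s] i
       | 1 => nth 0 [seq val e.1 | e <- es] i
       | 2 => nth 0 [seq val e.2 | e <- es] i
       | 3 => nth 0 [seq freq e | e <- es] i
       | _ => 0
       end%N)
    (fun a i => match a with
       | 0%N => nth 0 [:: eps; Dmin; Dmax] i
       | 1%N => nth 0 [seq ell e | e <- es] i
       | 2%N => nth 0 [seq d e | e <- es] i
       | _ => 0
       end).

(* A query overwrites cell 0 of word array 4 with t and cell 0 of real array 3
   with D. *)
Definition query_store (st : store R) (t : 'I_n) (D : R) : store R :=
  setr (setw st 4 0 (val t)) 3 0 D.

(* Cell 0 of word array 5 tells whether the answer is finite; if so, it is in
   cell 0 of real array 4. *)
Definition answer (st : store R) : \bar R :=
  if wmem st 5 0 == 0%N then +oo%E else (rmem st 4 0)%:E.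

End Interface.

(* Main.v *)
Require Import Defs.
From mathcomp Require Import all_boot all_order all_algebra.
From mathcomp Require Import classical_sets reals constructive_ereal ereal exp.
From mathcomp Require Import zify ring lra.

Set Implicit Arguments.
Unset Strict Implicit.
Unset Printing Implicit Defensive.

Import Order.TTheory GRing.Theory Num.Theory.
Local Open Scope ring_scope.

(* For each scale [2^i * Dmin], measure delays in units of [eps * 2^i * Dmin / h]
   and run a dynamic program over the [H = O(h / eps)] delay levels.  Let [P e]
   be the largest power of 2 up to the frequency of [e], and let a walk end each
   edge [e] only at levels that are multiples of [P e]: this costs at most [P e]
   units on [e], hence at most [h] units, i.e. [eps * 2^i * Dmin], on a path of
   frequency [h].  So [e] is relaxed only [H / P e] times, and the entries of a
   vertex are only needed at the multiples of the least period of the edges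
   entering it.  Sorting the edges by period, those to relax at a level form a
   prefix, which is how they are found without scanning all edges.  A level is
   strictly larger than its predecessors on a walk, even across edges of delay
   0, so increasing levels suffice.  Shortcutting a walk to a simple path never
   increases arrival times, so the values in the table are lengths of simple
   paths. *)

(** * Total-correctness logic for the word RAM *)

(** The time bound may be far below the number of vertices and the number of edges, and this shapes
    the program. Only the edges of frequency at most [h] are read; each contributes at least 1 to
    [h * Pi], so even one pass over them per possible period is affordable. No row of the table is
    ever initialized: cells start at 0, and a flag array tells which entries are set, an unset one
    standing for the length +oo. Carrying an entry of a vertex over to its next level is not a
    separate pass over vertices either; it is done while relaxing the edges that enter the vertex,
    so it is charged to them. Powers of two serve twice. They form a chain under divisibility, which
    is what makes the edges due at a level a prefix and lets all vertices share the multiples of the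
    least period. And they lose at most a factor 2, so that the sum of [H / P e] is at most
    [2 * H * Pi]. Correctness rests on two invariants of unequal strength: an entry is the length of
    some walk arriving in time, and it is at most the length of every such walk. Only the
    combination shows that it is the length of a simple path. *)

Section ProgramLogic.
Context {R : realType}.
Variable B : nat.
Implicit Types (st : store R) (Q : store R -> Prop).

(** Evaluation is split into a total value and the side conditions [okw] against overflow, so that
    reasoning about programs becomes arithmetic. A loaded cell adds no condition of its own: only
    words produced by arithmetic or by constants are checked. *)
Fixpoint valw st (e : wexp) : nat :=
  match e with
  | WConst k => k
  | WGet a i => wmem st a (valw st i)
  | WAdd x y => valw st x + valw st y
  | WSub x y => valw st x - valw st y
  | WMul x y => valw st x * valw st y
  | WDiv x y => valw st x %/ valw st y
  | WMod x y => valw st x %% valw st y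
  | WLog2 x => trunc_log 2 (valw st x)
  end%N.

Fixpoint okw st (e : wexp) : Prop :=
  match e with
  | WConst k => (k < B)%N
  | WGet a i => okw st i
  | WAdd x y | WSub x y | WMul x y | WDiv x y | WMod x y =>
      [/\ okw st x, okw st y & (valw st e < B)%N]
  | WLog2 x => okw st x /\ (valw st e < B)%N
  end.

Fixpoint valr st (e : rexp) : R :=
  match e with
  | RofW x => (valw st x)%:R
  | RGet a i => rmem st a (valw st i)
  | RAdd x y => valr st x + valr st y
  | RSub x y => valr st x - valr st y
  | RMul x y => valr st x * valr st y
  | RDiv x y => valr st x / valr st y
  end.

Fixpoint okr st (e : rexp) : Prop :=
  match e with
  | RofW x => okw st x
  | RGet a i => okw st i
  | RAdd x y | RSub x y | RMul x y | RDiv x y => okr st x /\ okr st y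
  end.

Fixpoint valc st (b : cond) : bool :=
  match b with
  | CLeW x y => (valw st x <= valw st y)%N
  | CLeR x y => valr st x <= valr st y
  | CNot x => ~~ valc st x
  | CAnd x y => valc st x && valc st y
  end.

Fixpoint okc st (b : cond) : Prop :=
  match b with
  | CLeW x y => okw st x /\ okw st y
  | CLeR x y => okr st x /\ okr st y
  | CNot x => okc st x
  | CAnd x y => okc st x /\ okc st y
  end.

Lemma evalw_val st e : okw st e -> evalw B st e = Some (valw st e).
Proof.
elim: e => //=.
- by move=> k lt_kB; rewrite /fit lt_kB.
- by move=> a i IH /IH ->.
- by move=> x IHx y IHy [/IHx-> /IHy-> lt_B]; rewrite /= /fit lt_B.
- by move=> x IHx y IHy [/IHx-> /IHy-> lt_B]; rewrite /= /fit lt_B.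
- by move=> x IHx y IHy [/IHx-> /IHy-> lt_B]; rewrite /= /fit lt_B.
- by move=> x IHx y IHy [/IHx-> /IHy-> lt_B]; rewrite /= /fit lt_B.
- by move=> x IHx y IHy [/IHx-> /IHy-> lt_B]; rewrite /= /fit lt_B.
- by move=> x IHx [/IHx-> lt_B]; rewrite /= /fit lt_B.
Qed.

Lemma evalr_val st e : okr st e -> evalr B st e = Some (valr st e).
Proof.
elim: e => //=.
- by move=> x /evalw_val->.
- by move=> a i /evalw_val->.
all: by move=> x IHx y IHy [/IHx-> /IHy->].
Qed.

Lemma evalc_val st b : okc st b -> evalc B st b = Some (valc st b).
Proof.
elim: b => //=.
- by move=> x y [/evalw_val-> /evalw_val->].
- by move=> x y [/evalr_val-> /evalr_val->].
- by move=> b IH /IH->.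
- by move=> x IHx y IHy [/IHx-> /IHy->].
Qed.

Definition run (c : cmd) st (k : nat) Q : Prop :=
  exists k' st', [/\ exec B c st k' st', (k' <= k)%N & Q st'].

Lemma run_imp c st k k' Q Q' :
  run c st k Q -> (k <= k')%N -> (forall st', Q st' -> Q' st') -> run c st k' Q'.
Proof.
move=> [l [st' [ex le_lk Qst']]] le_kk' QQ'.
by exists l, st'; split; [|apply: leq_trans le_kk'|apply: QQ'].
Qed.

Lemma run_seq c1 c2 st k1 k2 Q :
  run c1 st k1 (fun st' => run c2 st' k2 Q) -> run (Seq c1 c2) st (k1 + k2) Q.
Proof.
move=> [l1 [st1 [ex1 le1 [l2 [st2 [ex2 le2 Q2]]]]]].
by exists (l1 + l2)%N, st2; split; [apply: exec_seq ex1 ex2|apply: leq_add|].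
Qed.

Lemma run_if b c1 c2 st k Q :
  okc st b -> run (if valc st b then c1 else c2) st k Q ->
  run (If b c1 c2) st k.+1 Q.
Proof.
move=> /evalc_val okb [l [st' [ex le Qst']]].
by exists l.+1, st'; split=> //; apply: exec_if okb ex.
Qed.

(** The invariant is indexed by the number of finished iterations, and [N] is their exact total. The
    cost may vary with the iteration, which is what leaves room for the amortized count of
    relaxations. *)
Lemma run_while (b : cond) c (I : nat -> store R -> Prop) (cost : nat -> nat) N st :
  I 0%N st ->
  (forall i st', I i st' -> okc st' b /\ valc st' b = (i < N)%N) ->
  (forall i st', (i < N)%N -> I i st' -> run c st' (cost i) (I i.+1)) ->
  run (While b c) st (\sum_(i < N) (cost i).+1).+1 (I N).
Proof.
move=> I0 Ib Ic.
suff loop l i st' : (i + l = N)%N -> I i st' ->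
    run (While b c) st' (\sum_(i <= k < N) (cost k).+1).+1 (I N).
  by have := loop N 0%N st (add0n N) I0; rewrite big_mkord.
elim: l i st' => [|l IH] i st' iN Ii.
  rewrite addn0 in iN; rewrite iN in Ii *.
  exists 1%N, st'; split=> //; apply: exec_while_stop.
  by have [/evalc_val-> ->] := Ib _ _ Ii; rewrite ltnn.
have lt_iN : (i < N)%N by rewrite -iN; lia.
have [l1 [st1 [ex1 le1 I1]]] := Ic _ _ lt_iN Ii.
have [|l2 [st2 [ex2 le2 I2]]] := IH i.+1 st1 _ I1; first by rewrite -iN; lia.
exists (l1 + l2).+1, st2; split=> //.
  apply: exec_while_loop ex1 ex2.
  by have [/evalc_val-> ->] := Ib _ _ Ii; rewrite lt_iN.
by rewrite big_ltn // addSn ltnS -addnS leq_add // ltnW.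
Qed.

(** Meant for loop-free code: a loop gets the precondition [False] and has to go through
    [run_while]. Costs are then independent of the store and given by [steps]. *)
Fixpoint wp (c : cmd) st Q : Prop :=
  match c with
  | Skip => Q st
  | SetW a i e =>
      [/\ okw st i, okw st e & Q (setw st a (valw st i) (valw st e))]
  | SetR a i e =>
      [/\ okw st i, okr st e & Q (setr st a (valw st i) (valr st e))]
  | Floor a i e =>
      [/\ okw st i, okr st e, (Num.truncn (valr st e) < B)%N
        & Q (setw st a (valw st i) (Num.truncn (valr st e)))]
  | Seq c1 c2 => wp c1 st (fun st' => wp c2 st' Q)
  | If b c1 c2 => okc st b /\ (if valc st b then wp c1 st Q else wp c2 st Q)
  | While _ _ => False
  end.

Fixpoint steps (c : cmd) : nat :=
  match c with
  | Seq c1 c2 => steps c1 + steps c2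
  | If _ c1 c2 => (maxn (steps c1) (steps c2)).+1
  | _ => 1
  end%N.

Lemma run_wp c st Q : wp c st Q -> run c st (steps c) Q.
Proof.
elim: c st Q => //=.
- by move=> st Q Qst; exists 1%N, st; split=> //; apply: exec_skip.
- move=> a i e st Q [/evalw_val oki /evalw_val oke Qst].
  by exists 1%N, (setw st a (valw st i) (valw st e)); split=> //; apply: exec_setw.
- move=> a i e st Q [/evalw_val oki /evalr_val oke Qst].
  by exists 1%N, (setr st a (valw st i) (valr st e)); split=> //; apply: exec_setr.
- move=> a i e st Q [/evalw_val oki /evalr_val oke lt_B Qst].
  exists 1%N, (setw st a (valw st i) (Num.truncn (valr st e))); split=> //.
  by apply: exec_floor oki oke _; rewrite /fit lt_B.
- move=> c1 IH1 c2 IH2 st Q /IH1 wp1; apply: run_seq.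
  by apply: run_imp wp1 _ _ => // st' /IH2.
- move=> b c1 IH1 c2 IH2 st Q [okb wpb]; apply: run_if => //.
  case: (valc st b) wpb => [/IH1|/IH2] H; apply: run_imp H _ _ => //.
    exact: leq_maxl.
  exact: leq_maxr.
Qed.

End ProgramLogic.

(** * Walks with rounded arrival times *)

Lemma path_edges_rcons (n : nat) (s v : 'I_n) (p : seq 'I_n) :
  path_edges s (rcons p v) = rcons (path_edges s p) (last s p, v).
Proof.
rewrite /path_edges; elim: p s => //= u p IH s.
by rewrite -IH.
Qed.

Lemma path_weight_rcons (R : realType) (n : nat) (w : 'I_n * 'I_n -> R)
    (s v : 'I_n) (p : seq 'I_n) :
  path_weight w s (rcons p v) = path_weight w s p + w (last s p, v).
Proof. by rewrite /path_weight path_edges_rcons -cats1 big_cat big_seq1. Qed.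

Lemma path_freq_rcons (n : nat) (w : 'I_n * 'I_n -> nat)
    (s v : 'I_n) (p : seq 'I_n) :
  path_freq w s (rcons p v) = (path_freq w s p + w (last s p, v))%N.
Proof. by rewrite /path_freq path_edges_rcons -cats1 big_cat big_seq1. Qed.

Section Reach.
Context {R : realType} {n : nat}.
Notation edge := ('I_n * 'I_n)%type.
Variables (s : 'I_n) (sl : seq edge) (Pw : edge -> nat) (len : edge -> R).
Variable q : edge -> nat.

(* A walk may end edge [e] at any multiple of [Pw e] that is more than [q e]
   after its start, not only at the earliest one. *)
Inductive reach : 'I_n -> nat -> R -> Prop :=
| reach0 : reach s 0 0
| reachS u v a x a' :
    (u, v) \in sl -> reach u a x -> (Pw (u, v) %| a')%N ->
    (a + q (u, v) < a')%N -> reach v a' (x + len (u, v)).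

Lemma reach_edge e a x a' : e \in sl -> reach e.1 a x -> (Pw e %| a')%N ->
  (a + q e < a')%N -> reach e.2 a' (x + len e).
Proof. by case: e => u v; apply: reachS. Qed.

Inductive simple_reach : 'I_n -> seq 'I_n -> nat -> R -> Prop :=
| simple_reach0 : simple_reach s [::] 0 0
| simple_reachS u v p a x a' :
    (u, v) \in sl -> simple_reach u p a x -> v \notin s :: p ->
    (Pw (u, v) %| a')%N -> (a + q (u, v) < a')%N ->
    simple_reach v (rcons p v) a' (x + len (u, v)).

Lemma simple_reach_reach v p a x : simple_reach v p a x -> reach v a x.
Proof.
elim=> [|u w p' b y b' uw _ IH _ dvd lt]; first exact: reach0.
exact: reachS uw IH dvd lt.
Qed.

Hypothesis len_ge0 : forall e, e \in sl -> 0 <= len e.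

(** Truncating a walk at a vertex it visits: levels grow along a walk and lengths are non-negative,
    so the prefix is no worse in either respect. *)
Lemma simple_reach_prefix v p a x w :
  simple_reach v p a x -> w \in s :: p ->
  exists p' a' x', [/\ simple_reach w p' a' x', (a' <= a)%N & x' <= x].
Proof.
elim=> [|u v' p' b y b' uv W IH nv dvd lt].
  by rewrite inE => /eqP->; exists [::], 0%N, 0; split=> //; apply: simple_reach0.
rewrite -rcons_cons mem_rcons inE => /orP[/eqP->|/IH].
  exists (rcons p' v'), b', (y + len (u, v')); split=> //.
  exact: simple_reachS uv W nv dvd lt.
move=> [p2 [a2 [x2 [W2 le2 lex2]]]]; exists p2, a2, x2; split=> //.
  by lia.
by apply: le_trans lex2 _; rewrite lerDl len_ge0.
Qed.

(* Cutting out a cycle delays nothing, because arrival times are rounded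
   monotonically. *)
Lemma reach_simple v a x : reach v a x ->
  exists p a' x', [/\ simple_reach v p a' x', (a' <= a)%N & x' <= x].
Proof.
elim=> [|u w b y b' uw _ [p [a1 [x1 [W le_a le_x]]]] dvd lt].
  by exists [::], 0%N, 0; split=> //; apply: simple_reach0.
have le_y : x1 <= y + len (u, w) by apply: le_trans le_x _; rewrite lerDl len_ge0.
have [wp|nwp] := boolP (w \in s :: p).
  have [p2 [a2 [x2 [W2 le2 lex2]]]] := simple_reach_prefix W wp.
  exists p2, a2, x2; split=> //; last exact: le_trans le_y.
  by lia.
exists (rcons p w), b', (x1 + len (u, w)); split=> //; last exact: lerD.
apply: simple_reachS uw W nwp dvd _; lia.
Qed.

Lemma simple_reach_is_path (E : {set edge}) v p a x :
  {subset sl <= E} -> simple_reach v p a x ->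
  is_path E s v p /\ x = path_weight len s p.
Proof.
move=> slE; elim=> [|u w p' b y b' uw _ [[Ep up pu] ->] nw _ _].
  by split=> //; rewrite /path_weight big_nil.
split; last by rewrite path_weight_rcons up.
split; first by rewrite rcons_path Ep up slE.
  by rewrite last_rcons.
by rewrite -rcons_cons rcons_uniq nw.
Qed.

Variables (d : edge -> R) (unit : R).
Hypothesis unit_gt0 : 0 < unit.
Hypothesis d_ge0 : forall e, e \in sl -> 0 <= d e.
Hypothesis qE : forall e, q e = Num.truncn (d e / unit).

(** The strict inequality in [simple_reach] makes up for truncating [d e / unit]: an edge takes at
    least [q e + 1] levels, which is more than its delay in units. *)
Lemma simple_reach_delay v p a x :
  simple_reach v p a x -> path_weight d s p <= a%:R * unit.
Proof.
suff H : simple_reach v p a x -> last s p = v /\ path_weight d s p <= a%:R * unit.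
  by move=> /H[].
elim=> [|u w p' b y b' uw _ [up le_b] nw _ lt].
  by split=> //; rewrite /path_weight big_nil mul0r.
rewrite last_rcons path_weight_rcons up; split=> //.
have le1 : (b + (q (u, w)).+1)%:R * unit <= b'%:R * unit.
  by rewrite ler_pM2r // ler_nat addnS.
apply: le_trans le1; rewrite natrD mulrDl lerD //.
rewrite -ler_pdivrMr // ltW // qE truncnS_gt //.
Qed.

Variables (E : {set edge}) (freq : edge -> nat) (h : nat).
Hypothesis slE : forall e, e \in E -> (freq e <= h)%N -> e \in sl.
Hypothesis Pw_gt0 : forall e, e \in sl -> (0 < Pw e)%N.
Hypothesis Pw_le : forall e, e \in sl -> (Pw e <= freq e)%N.

(** Each edge ends at the first multiple of [Pw e] strictly above [a + q e], which is at most
    [a + q e + Pw e]. Since [q e] is rounded down, truncation and rounding up together lose at most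
    [Pw e <= freq e] units, without an extra unit for strictness. *)
Lemma path_reach p : path (fun u v => (u, v) \in E) s p ->
  (path_freq freq s p <= h)%N ->
  exists a, reach (last s p) a (path_weight len s p) /\
    a%:R <= path_weight d s p / unit + (path_freq freq s p)%:R.
Proof.
elim/last_ind: p => [_ _|p v IH].
  exists 0%N; rewrite /path_weight /path_freq !big_nil; split; first exact: reach0.
  by rewrite mul0r addr0.
rewrite rcons_path path_freq_rcons => /andP[Ep Ev] le_h.
have [|a [ra le_a]] := IH Ep; first by lia.
rewrite last_rcons !path_weight_rcons.
set e := (last s p, v) in Ev le_h *.
have slv : e \in sl by apply: slE => //; lia.
have P0 := Pw_gt0 slv; have Pf := Pw_le slv.
exists (((a + q e) %/ Pw e).+1 * Pw e)%N; split.
  by apply: reachS ra _ _ => //; [rewrite dvdn_mull|exact: ltn_ceil].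
have le1 : (((a + q e) %/ Pw e).+1 * Pw e <= a + q e + freq e)%N.
  by rewrite mulSn addnC leq_add // leq_trunc_div.
have le2 : (q e)%:R <= d e / unit.
  by rewrite qE truncn_le // divr_ge0 // ?d_ge0 // ltW.
move: le1; rewrite -(ler_nat R) => le1; apply: le_trans le1 _.
rewrite !natrD mulrDl; lra.
Qed.

End Reach.

(** * Periods of vertices and divisibility of arrival levels *)

Section Period.
Context {R : realType} {n : nat}.
Notation edge := ('I_n * 'I_n)%type.
Variable Pw : edge -> nat.
Implicit Types (sl : seq edge) (v : nat).

(* The least period of an edge into [v] when [sl] is sorted by periods, and 0
   if there is no such edge. *)
Definition period sl v : nat :=
  head 0%N [seq Pw e | e <- sl & nat_of_ord e.2 == v].

(** This is the update performed by [append_edge]. Positive periods make 0 a safe mark for a vertex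
    that no edge enters yet. *)
Lemma period_rcons sl e v :
  (forall e', e' \in sl -> 0 < Pw e')%N ->
  period (rcons sl e) v =
    if (v == e.2 :> nat) && (period sl v == 0%N) then Pw e else period sl v.
Proof.
move=> Pw_gt0; rewrite /period filter_rcons eq_sym.
case: (altP (v =P e.2 :> nat)) => [vE|_] //=; rewrite map_rcons headI.
case def_l: [seq _ | _ <- _] => [|k l] //=.
have: k \in [seq Pw e | e <- sl & nat_of_ord e.2 == v] by rewrite def_l mem_head.
case/mapP => e'; rewrite mem_filter => /andP[_ /Pw_gt0].
by move=> + kE; rewrite kE; case: (Pw e').
Qed.

Variable sl : seq edge.
Hypothesis Pw_gt0 : forall e, e \in sl -> (0 < Pw e)%N.
Hypothesis sl_sorted : sorted (fun e f => Pw e %| Pw f)%N sl.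

Let dvd_trans : transitive (fun e f => Pw e %| Pw f)%N.
Proof. by move=> ? ? ?; apply: dvdn_trans. Qed.

Lemma period_leader e : e \in sl ->
  exists2 e', e' \in sl & e'.2 = e.2 /\ Pw e' = period sl e.2.
Proof.
move=> esl; rewrite /period.
case def_l: [seq e <- sl | _] => [|e' l].
  have: e \in [seq f <- sl | nat_of_ord f.2 == e.2] by rewrite mem_filter eqxx.
  by rewrite def_l.
have: e' \in [seq f <- sl | nat_of_ord f.2 == e.2] by rewrite def_l mem_head.
rewrite mem_filter => /andP[/eqP/val_inj e2 esl'].
by exists e'.
Qed.

Lemma period_dvd e : e \in sl -> (period sl e.2 %| Pw e)%N.
Proof.
move=> esl; rewrite /period.
have := sorted_filter dvd_trans (fun f : edge => nat_of_ord f.2 == e.2) sl_sorted.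
have: e \in [seq f <- sl | nat_of_ord f.2 == e.2] by rewrite mem_filter eqxx.
case: [seq _ <- _ | _] => //= f l; rewrite inE => /orP[/eqP->//|el].
by rewrite (path_sortedE dvd_trans) => /andP[/allP/(_ _ el)].
Qed.

Lemma period_gt0 e : e \in sl -> (0 < period sl e.2)%N.
Proof. by move=> /period_leader[e' /Pw_gt0 + [_ <-]]. Qed.

Lemma head_dvd e : e \in sl -> (head 0%N [seq Pw f | f <- sl] %| Pw e)%N.
Proof.
case: sl sl_sorted => //= f l; rewrite (path_sortedE dvd_trans) inE.
by move=> /andP[/allP all_l _] /orP[/eqP->//|/all_l].
Qed.

Lemma head_dvd_period v : (head 0%N [seq Pw f | f <- sl] %| period sl v)%N.
Proof.
rewrite /period; case def_l: [seq e <- sl | _] => [|e' l] //=.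
apply: head_dvd; have: e' \in [seq f <- sl | nat_of_ord f.2 == v] by rewrite def_l mem_head.
by rewrite mem_filter => /andP[].
Qed.

(** For a vertex that no edge enters the period is 0, and the divisibility then says that the
    arrival level is 0. *)
Lemma reach_period (s w : 'I_n) (len : edge -> R) q a x :
  reach s sl Pw len q w a x -> (period sl w %| a)%N.
Proof.
elim=> [|u w1 b y b' uw _ _ dvd _]; first exact: dvdn0.
exact: dvdn_trans (period_dvd uw) dvd.
Qed.

End Period.

(** * The table and its invariants *)

Section Memory.
Context {R : realType}.
Implicit Types (F : nat -> nat) (X : nat -> R) (c i : nat) (x y : R).

Definition write {T : Type} (f : nat -> T) i (x : T) : nat -> T :=
  fun j => if j == i then x else f j.

(** With an unset flag read as +oo, this is the comparison of an entry with [x]. *)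
Definition good F X c x : Prop := (0 < F c)%N /\ X c <= x.

(** The pointwise order on tables. The program only moves down in it, so completeness established
    for earlier levels and scales survives later writes. *)
Definition lower F X F' X' : Prop :=
  forall c x, good F X c x -> good F' X' c x.

Lemma lower_trans F X F1 X1 F2 X2 :
  lower F X F1 X1 -> lower F1 X1 F2 X2 -> lower F X F2 X2.
Proof. by move=> le1 le2 c x /le1/le2. Qed.

Definition better F X c i y : bool :=
  (0 < F i)%N && ~~ ((0 < F c)%N && (X c <= X i + y)).

Definition offerF F X c i y := if better F X c i y then write F c 1%N else F.
Definition offerX F X c i y := if better F X c i y then write X c (X i + y) else X.

Lemma offer_lower F X c i y : lower F X (offerF F X c i y) (offerX F X c i y).
Proof.
move=> c' x [F0 Xx]; rewrite /offerF /offerX; case: ifP => // /andP[_ nb].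
rewrite /good /write; case: eqP => [cE|_]; split=> //.
by move: nb; rewrite -cE F0 -ltNge => /ltW/le_trans; apply.
Qed.

Lemma offer_good F X c i y x :
  good F X i x -> good (offerF F X c i y) (offerX F X c i y) c (x + y).
Proof.
move=> [F0 Xx]; rewrite /good /offerF /offerX; have [bt|] := boolP (better _ _ _ _ _).
  by rewrite /write eqxx; split=> //; rewrite lerD2r.
rewrite /better F0 /= negbK => /andP[Fc Xc]; split=> //.
by apply: le_trans Xc _; rewrite lerD2r.
Qed.

End Memory.

Section Table.
Context {R : realType} {n : nat}.
Notation edge := ('I_n * 'I_n)%type.
Variables (s : 'I_n) (sl : seq edge) (Pw : edge -> nat) (len : edge -> R).
Variables (q : nat -> edge -> nat) (H : nat).
Implicit Types (F : nat -> nat) (X : nat -> R) (sg i j v : nat).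

Notation pv v := (period Pw sl v).

(* Row [v] of scale [sg] only has entries for the levels that are multiples of
   [pv v]; entry [i] stands for level [i * pv v]. *)
Definition cell sg v i : nat := ((sg * n + v) * H.+1 + i)%N.

Lemma cell_inj sg v i sg' v' i' :
  (v < n)%N -> (v' < n)%N -> (i <= H)%N -> (i' <= H)%N ->
  cell sg v i = cell sg' v' i' -> [/\ sg = sg', v = v' & i = i'].
Proof.
move=> vn vn' iH iH' cE.
have rowE : (sg * n + v = sg' * n + v')%N.
  by have := congr1 (divn^~ H.+1) cE; rewrite !divnMDl // !divn_small ?addn0.
have n0 : (0 < n)%N by apply: leq_ltn_trans vn.
have sE : sg = sg'.
  by have := congr1 (divn^~ n) rowE; rewrite !divnMDl // !divn_small ?addn0.
have vE : v = v' by move: rowE; rewrite sE => /addnI.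
by split=> //; move: cE; rewrite /cell sE vE => /addnI.
Qed.

(** Only a walk is promised, since the table does not record visited vertices. It may arrive before
    the level of the entry because entries are carried forward. *)
Definition sound F X : Prop :=
  forall sg (v : 'I_n) i, (i <= H)%N -> (0 < F (cell sg v i))%N ->
  exists2 a, (a <= i * pv v)%N & reach s sl Pw len (q sg) v a (X (cell sg v i)).

(** A level is answered by the last entry of the row at or before it, whence the quotient. In a row
    of period 0 division by 0 yields 0, so entry 0 answers all levels. *)
Definition complete sg j F X : Prop :=
  forall (v : 'I_n) a x j', reach s sl Pw len (q sg) v a x ->
  (a <= j')%N -> (j' < j)%N -> (j' <= H)%N -> good F X (cell sg v (j' %/ pv v)) x.

(** The first half carries older arrivals forward, the second one uses the edge. Stating the first
    half for an edge rather than for its head matches the way in which the program pays for it. *)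
Definition relaxed sg j F X (e : edge) : Prop :=
  let c := cell sg e.2 (j %/ pv e.2) in
  (forall a x, reach s sl Pw len (q sg) e.2 a x -> (a < j)%N -> good F X c x) /\
  (forall a x, reach s sl Pw len (q sg) e.1 a x -> (a + q sg e < j)%N ->
     good F X c (x + len e)).

Lemma complete_lower sg j F X F' X' :
  lower F X F' X' -> complete sg j F X -> complete sg j F' X'.
Proof. by move=> le cmp v a x j' r aj jj jH; apply: le; apply: cmp r aj jj jH. Qed.

Lemma relaxed_lower sg j F X F' X' e :
  lower F X F' X' -> relaxed sg j F X e -> relaxed sg j F' X' e.
Proof.
move=> le [rA rB]; split=> a x r aj; apply: le; first exact: rA r aj.
exact: rB r aj.
Qed.

Lemma sound_write F X sg (v : 'I_n) i a x :
  sound F X -> (i <= H)%N -> (a <= i * pv v)%N ->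
  reach s sl Pw len (q sg) v a x ->
  sound (write F (cell sg v i) 1%N) (write X (cell sg v i) x).
Proof.
move=> snd iH ai rx sg' v' i' iH'; rewrite /write; case: eqP => [cE _|_]; last exact: snd.
have [sgE vE iE] := cell_inj (ltn_ord _) (ltn_ord _) iH' iH cE.
by rewrite sgE iE (val_inj vE); exists a.
Qed.

Lemma sound_offer F X sg (v : 'I_n) i c y :
  sound F X -> (i <= H)%N ->
  ((0 < F c)%N -> exists2 a, (a <= i * pv v)%N &
     reach s sl Pw len (q sg) v a (X c + y)) ->
  sound (offerF F X (cell sg v i) c y) (offerX F X (cell sg v i) c y).
Proof.
move=> snd iH just; rewrite /offerF /offerX; case: ifP => // /andP[/just[a ai r] _].
exact: sound_write r.
Qed.

Hypothesis Pw_gt0 : forall e, e \in sl -> (0 < Pw e)%N.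
Hypothesis sl_sorted : sorted (fun e f => Pw e %| Pw f)%N sl.

Notation P0 := (head 0%N [seq Pw e | e <- sl]).

Lemma reach_le0 qs (v : 'I_n) a x :
  reach s sl Pw len qs v a x -> a = 0%N -> v = s /\ x = 0.
Proof. by case=> // u w b y b' _ _ _ lt b'0; move: lt; rewrite b'0. Qed.

Lemma reach_head qs (v : 'I_n) a x : reach s sl Pw len qs v a x -> (P0 %| a)%N.
Proof.
by move=> r; apply: dvdn_trans (reach_period sl_sorted r); exact: head_dvd_period.
Qed.

(** [P0] divides all periods, so no row starts a new entry strictly between two multiples of [P0],
    and the main loop may advance by [P0]. *)
Lemma period_div v j j' : (0 < P0)%N -> (P0 %| j)%N -> (j <= j' < j + P0)%N ->
  (j' %/ pv v = j %/ pv v)%N.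
Proof.
move=> P0_gt0 /dvdnP[l ->] /andP[le lt].
have [->|pv0] := posnP (pv v); first by rewrite !divn0.
have /dvdnP[k pvE] := head_dvd_period sl_sorted v.
rewrite pvE [(k * _)%N]mulnC !divnMA mulnK //; congr (_ %/ k)%N.
by apply/eqP; rewrite eqn_leq leq_divRL // -ltnS ltn_divLR // mulSn addnC lt le.
Qed.

Lemma complete_init sg F X : (0 < P0)%N ->
  good F X (cell sg s 0) 0 -> complete sg P0 F X.
Proof.
move=> P0_gt0 g0 v a x j' r aj jP jH.
have a0 : a = 0%N.
  have /dvdn_leq := reach_head r; case: (a) aj => // a' aj /(_ isT); lia.
have [-> ->] := reach_le0 r a0.
by rewrite (@period_div _ 0) ?div0n ?add0n.
Qed.

Lemma relaxed_offers sg j F X F' X' e :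
  e \in sl -> (0 < j)%N -> (j <= H)%N -> (Pw e %| j)%N -> complete sg j F X ->
  (forall x, good F X (cell sg e.2 (j %/ pv e.2)).-1 x ->
     good F' X' (cell sg e.2 (j %/ pv e.2)) x) ->
  ((q sg e < j)%N -> forall x,
     good F X (cell sg e.1 ((j - (q sg e).+1) %/ pv e.1)) x ->
     good F' X' (cell sg e.2 (j %/ pv e.2)) (x + len e)) ->
  relaxed sg j F' X' e.
Proof.
move=> esl j0 jH Pj cmp copy edge_.
have pv_gt0 := period_gt0 Pw_gt0 esl.
have pvj := dvdn_trans (period_dvd sl_sorted esl) Pj.
split=> a x r aj; last first.
  by apply: edge_; [lia|apply: cmp r _ _ _; lia].
apply: copy; have /dvdnP[[|k] jE] := pvj; first by rewrite jE in j0.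
(* As the period divides [j > 0], the entry just before the one of level [j] is the one in charge of
   level [j - 1]. *)
have -> : (cell sg e.2 (j %/ pv e.2)).-1 = cell sg e.2 (j.-1 %/ pv e.2).
  have -> : (j.-1 %/ pv e.2 = k)%N.
    apply/eqP; rewrite eqn_leq leq_divRL // -ltnS ltn_divLR // -jE.
    by move: jE pv_gt0; rewrite mulSn; lia.
  by rewrite jE mulnK // /cell addnS.
by apply: cmp r _ _ _; lia.
Qed.

(** If the period of [v] does not divide [j], or is 0, no walk arrives exactly at [j], and the entry
    for [j - 1] still serves. Otherwise an arrival before [j] is carried over by the edge that
    attains the least period, which is due at [j], and an arrival at [j] ends with an edge that is
    itself due at [j]. *)
Lemma complete_level sg j F X : (0 < P0)%N -> (P0 %| j)%N -> (0 < j)%N -> (j <= H)%N ->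
  complete sg j F X ->
  (forall e, e \in sl -> (Pw e %| j)%N -> relaxed sg j F X e) ->
  complete sg (j + P0) F X.
Proof.
move=> P0_gt0 P0j j0 jH cmp rel v a x j' r aj' j'lt j'H.
have [lt_jj|le_jj] := ltnP j' j; first exact: cmp r aj' lt_jj j'H.
have aj : (a <= j)%N.
  have /dvdnP[k aE] := reach_head r; have /dvdnP[l jE] := P0j.
  suff : (k < l.+1)%N by rewrite aE jE leq_mul2r ltnS => ->; rewrite orbT.
  rewrite -(ltn_pmul2r P0_gt0) -aE mulSn -jE; lia.
rewrite (period_div _ P0_gt0 P0j) ?le_jj //.
have [pvj|npvj] := boolP ((0 < pv v) && (pv v %| j))%N; last first.
  have aj1 : (a <= j.-1)%N.
    suff : a != j by lia.
    apply: contraNneq npvj => ajE; have pva := reach_period sl_sorted r.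
    rewrite -ajE pva andbT lt0n; apply: contraTneq pva => ->.
    by rewrite dvd0n ajE -lt0n.
  have -> : (j %/ pv v = j.-1 %/ pv v)%N.
    have [->|pv0] := posnP (pv v); first by rewrite !divn0.
    move: npvj; rewrite pv0 /= => nd.
    by rewrite -{1}(prednK j0) divnS // prednK // (negbTE nd).
  by apply: cmp r _ _ _; lia.
have /andP[pv0 dvdj] := pvj.
have [lt_aj|] := ltnP a j.
  have [e esl vE] : exists2 e, e \in sl & nat_of_ord e.2 = v.
    move: pv0; rewrite /period; case def_l: [seq _ <- _ | _] => [|e l] //= _.
    have : e \in [seq e <- sl | nat_of_ord e.2 == v] by rewrite def_l mem_head.
    by rewrite mem_filter => /andP[/eqP ? ?]; exists e.
  have [e' esl' [eE PE]] := period_leader Pw esl.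
  have Pe' : (Pw e' %| j)%N by rewrite PE vE.
  have [rA _] := rel _ esl' Pe'.
  have vE' : v = e'.2 by apply: val_inj; rewrite eE; exact: esym vE.
  by rewrite vE' in r *; apply: rA r lt_aj.
move=> le_ja; have {aj le_ja} ajE : a = j by lia.
case: r ajE => [j0'|u w b y b' uw r Pb lt b'E]; first by lia.
rewrite {}b'E in Pb lt.
by have [_ /(_ _ _ r lt)] := rel _ uw Pb.
Qed.

End Table.

(** * The programs *)

(* Word arrays 6, 7, 8 hold the tail, head and period of the sorted edges, 9
   the period of each vertex, 22 the flags of the table; real arrays 5, 6 hold
   the lengths and delays of the sorted edges, 7 the time unit of each scale,
   8 the table.  The other arrays are registers. *)
Definition reg (a : nat) : wexp := WGet a (WConst 0).
Definition rreg (a : nat) : rexp := RGet a (WConst 0).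
Definition setreg (a : nat) (e : wexp) : cmd := SetW a (WConst 0) e.
Definition numV : wexp := WGet 0 (WConst 0).
Definition numE : wexp := WGet 0 (WConst 1).
Definition budget : wexp := WGet 0 (WConst 2).
Definition source : wexp := WGet 0 (WConst 3).
Definition incr (a : nat) : cmd := setreg a (WAdd (reg a) (WConst 1)).

(** Stops at the first edge of frequency above [h], so that the cost does not depend on the number
    of edges. The first test guards the end of the listing: the cells beyond it hold 0 and would
    pass the second test. *)
Definition count_edges : cmd :=
  While (CAnd (CNot (CLeW numE (reg 10))) (CLeW (WGet 3 (reg 10)) budget))
    (incr 10).

Definition append_edge : cmd :=
  let k := reg 16 in
  let c := reg 15 in
  Seq (SetW 6 c (WGet 1 k)) (Seq (SetW 7 c (WGet 2 k)) (Seq (SetW 8 c (reg 14))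
  (Seq (SetR 5 c (RGet 1 k)) (Seq (SetR 6 c (RGet 2 k))
  (Seq (If (CLeW (WGet 9 (WGet 2 k)) (WConst 0)) (SetW 9 (WGet 2 k) (reg 14)) Skip)
    (incr 15)))))).

Definition sort_body : cmd :=
  Seq (If (CAnd (CLeW (reg 13) (WLog2 (WGet 3 (reg 16))))
                (CLeW (WLog2 (WGet 3 (reg 16))) (reg 13))) append_edge Skip)
      (incr 16).

(** A bucket sort with one pass per power of two up to [h]; register 13 holds the exponent and
    register 14 the power. *)
Definition sort_edges : cmd :=
  Seq (setreg 14 (WConst 1))
  (While (CLeW (reg 13) (WLog2 budget))
    (Seq (setreg 16 (WConst 0))
    (Seq (While (CNot (CLeW (reg 10) (reg 16))) sort_body)
         (Seq (incr 13) (setreg 14 (WMul (reg 14) (WConst 2))))))).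

Definition cell_exp (v lvl : wexp) : wexp :=
  WAdd (WMul (WAdd (WMul (reg 17) numV) v) (WAdd (reg 11) (WConst 1)))
       (WDiv lvl (WGet 9 v)).

Definition offer (y : rexp) : cmd :=
  let c := reg 20 in
  let i := reg 21 in
  If (CAnd (CNot (CLeW (WGet 22 i) (WConst 0)))
       (CNot (CAnd (CNot (CLeW (WGet 22 c) (WConst 0)))
                   (CLeR (RGet 8 c) (RAdd (RGet 8 i) y)))))
    (Seq (SetR 8 c (RAdd (RGet 8 i) y)) (SetW 22 c (WConst 1)))
    Skip.

(** Register 20 addresses the entry to improve, register 21 the entry offered to it: first its
    predecessor in the row with no extra length, then an entry of the tail. The comparison before
    [Floor] is there because delays are unbounded and the quotient might not fit in a word. *)
Definition relax : cmd :=
  let k := reg 16 in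
  Seq (setreg 20 (cell_exp (WGet 7 k) (reg 18)))
  (Seq (setreg 21 (WSub (reg 20) (WConst 1)))
  (Seq (offer (RofW (WConst 0)))
  (If (CLeR (RGet 6 k) (RMul (RofW (reg 11)) (RGet 7 (reg 17))))
    (Seq (Floor 19 (WConst 0) (RDiv (RGet 6 k) (RGet 7 (reg 17))))
      (If (CLeW (WAdd (reg 19) (WConst 1)) (reg 18))
        (Seq (setreg 21 (cell_exp (WGet 6 k) (WSub (reg 18) (WAdd (reg 19) (WConst 1)))))
             (offer (RGet 5 k)))
        Skip))
    Skip))).

Definition level_loop : cmd :=
  While (CAnd (CNot (CLeW (reg 10) (reg 16)))
              (CLeW (WMod (reg 18) (WGet 8 (reg 16))) (WConst 0)))
    (Seq relax (incr 16)).

Definition scale_loop : cmd :=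
  While (CLeW (reg 18) (reg 11))
    (Seq (setreg 16 (WConst 0))
    (Seq level_loop (setreg 18 (WAdd (reg 18) (WGet 8 (WConst 0)))))).

Definition scale_init : cmd :=
  Seq (SetR 7 (reg 17) (RDiv (RMul (rreg 0) (rreg 9)) (RofW budget)))
  (Seq (setreg 20 (WMul (WAdd (WMul (reg 17) numV) source) (WAdd (reg 11) (WConst 1))))
  (Seq (SetW 22 (reg 20) (WConst 1))
  (Seq (SetR 8 (reg 20) (RofW (WConst 0)))
       (setreg 18 (WGet 8 (WConst 0)))))).

Definition all_scales : cmd :=
  Seq (SetR 9 (WConst 0) (RGet 0 (WConst 1)))
  (While (CLeW (reg 17) (reg 12))
    (Seq scale_init (Seq scale_loop
      (Seq (incr 17) (SetR 9 (WConst 0) (RAdd (rreg 9) (rreg 9))))))).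

Definition set_bounds : cmd :=
  Seq (Floor 11 (WConst 0) (RDiv (RMul (RofW (WConst 2)) (RofW budget)) (rreg 0)))
  (Seq (setreg 11 (WAdd (reg 11) budget))
  (Seq (Floor 12 (WConst 0) (RDiv (RGet 0 (WConst 2)) (RGet 0 (WConst 1))))
       (setreg 12 (WLog2 (reg 12))))).

Definition preprocess : cmd :=
  Seq count_edges
  (If (CLeW (reg 10) (WConst 0)) Skip
    (Seq set_bounds (Seq sort_edges all_scales))).

(** The target [s] is treated apart because preprocessing builds no table when no edge has frequency
    at most [h]. *)
Definition query : cmd :=
  let t := WGet 4 (WConst 0) in
  If (CAnd (CLeW t source) (CLeW source t))
    (Seq (SetW 5 (WConst 0) (WConst 1)) (SetR 4 (WConst 0) (RofW (WConst 0))))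
    (Seq (Floor 17 (WConst 0) (RDiv (rreg 3) (RGet 0 (WConst 1))))
    (Seq (setreg 17 (WLog2 (reg 17)))
    (Seq (Floor 19 (WConst 0) (RDiv (rreg 3) (RGet 7 (reg 17))))
    (Seq (setreg 20 (cell_exp t (WAdd (reg 19) budget)))
    (Seq (SetW 5 (WConst 0) (WGet 22 (reg 20)))
         (SetR 4 (WConst 0) (RGet 8 (reg 20)))))))).

(** * Frame conditions and rules for single instructions *)

Section Same.
Context {R : realType}.
Implicit Types st : store R.

Definition same (aw ar : seq nat) st st' : Prop :=
  (forall a, a \notin aw -> wmem st' a = wmem st a) /\
  (forall a, a \notin ar -> rmem st' a = rmem st a).

Lemma same_trans aw ar st1 st2 st3 :
  same aw ar st1 st2 -> same aw ar st2 st3 -> same aw ar st1 st3.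
Proof.
move=> [w12 r12] [w23 r23]; split=> a na; first by rewrite w23 ?w12.
by rewrite r23 ?r12.
Qed.

Lemma same_sub aw ar aw' ar' st st' :
  all (fun a => a \in aw') aw -> all (fun a => a \in ar') ar ->
  same aw ar st st' -> same aw' ar' st st'.
Proof.
move=> /allP sw /allP sr [w r]; split=> a na; first by apply: w; apply: contra na => /sw.
by apply: r; apply: contra na => /sr.
Qed.

Lemma same_setw aw ar st st' a i x :
  a \in aw -> same aw ar st st' -> same aw ar st (setw st' a i x).
Proof.
move=> aaw [w r]; split=> // b nb; rewrite -w //= /upd.
by rewrite (_ : (b == a) = false) //; apply: contraNF nb => /eqP->.
Qed.

Lemma same_setr aw ar st st' a i x :
  a \in ar -> same aw ar st st' -> same aw ar st (setr st' a i x).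
Proof.
move=> aaw [w r]; split=> // b nb; rewrite -r //= /upd.
by rewrite (_ : (b == a) = false) //; apply: contraNF nb => /eqP->.
Qed.

End Same.

Section Offer.
Context {R : realType}.
Variable B : nat.

Lemma wp_seq c1 c2 (st : store R) Q :
  wp B c1 st (fun st' => wp B c2 st' Q) -> wp B (Seq c1 c2) st Q.
Proof. by []. Qed.

Lemma wp_if b c1 c2 (st : store R) Q :
  okc B st b -> (valc st b -> wp B c1 st Q) -> (~~ valc st b -> wp B c2 st Q) ->
  wp B (If b c1 c2) st Q.
Proof. by move=> okb w1 w2; split=> //; case: ifP => [/w1|/negbT/w2]. Qed.

Lemma wp_setreg a e (st : store R) Q : (0 < B)%N -> okw B st e ->
  (forall st', same [:: a] [::] st st' -> wmem st' a 0 = valw st e -> Q st') ->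
  wp B (setreg a e) st Q.
Proof.
move=> B0 oke HQ; split=> //; apply: HQ; first by apply: same_setw; rewrite ?mem_head.
by rewrite /= /upd !eqxx.
Qed.

Lemma wp_floor a e (st : store R) Q : (0 < B)%N -> okr B st e ->
  (Num.truncn (valr st e) < B)%N ->
  (forall st', same [:: a] [::] st st' ->
     wmem st' a 0 = Num.truncn (valr st e) -> Q st') ->
  wp B (Floor a (WConst 0) e) st Q.
Proof.
move=> B0 oke lt_B HQ; split=> //; apply: HQ; first by apply: same_setw; rewrite ?mem_head.
by rewrite /= /upd !eqxx.
Qed.

Lemma wp_setw a i e (st : store R) Q : okw B st i -> okw B st e ->
  (forall st', same [:: a] [::] st st' ->
     wmem st' a = write (wmem st a) (valw st i) (valw st e) -> Q st') ->
  wp B (SetW a i e) st Q.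
Proof.
move=> oki oke HQ; split=> //; apply: HQ; first by apply: same_setw; rewrite ?mem_head.
by rewrite /= /upd eqxx.
Qed.

Lemma wp_setr a i e (st : store R) Q : okw B st i -> okr B st e ->
  (forall st', same [::] [:: a] st st' ->
     rmem st' a = write (rmem st a) (valw st i) (valr st e) -> Q st') ->
  wp B (SetR a i e) st Q.
Proof.
move=> oki oke HQ; split=> //; apply: HQ; first by apply: same_setr; rewrite ?mem_head.
by rewrite /= /upd eqxx.
Qed.

Lemma wp_offer (st : store R) y Q : (1 < B)%N -> okr B st y ->
  (forall st', same [:: 22]%N [:: 8]%N st st' ->
     wmem st' 22 = offerF (wmem st 22) (rmem st 8) (wmem st 20 0) (wmem st 21 0) (valr st y) ->
     rmem st' 8 = offerX (wmem st 22) (rmem st 8) (wmem st 20 0) (wmem st 21 0) (valr st y) ->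
     Q st') ->
  wp B (offer y) st Q.
Proof.
move=> B1 oky HQ; have B0 : (0 < B)%N by lia.
split; first by rewrite /=.
move: HQ; rewrite /offerF /offerX /= -!ltnNge -/(better _ _ _ _ _).
case: ifP => _ HQ; last exact: HQ.
split=> //=; split=> //=; apply: HQ => //.
by apply: same_setw => //; apply: same_setr.
Qed.

End Offer.

(** * Filling the table *)

Section SortedArrays.
Context {R : realType} {n : nat}.
Notation edge := ('I_n * 'I_n)%type.
Variables (Pw : edge -> nat) (len d : edge -> R).

Record arrays (sl : seq edge) (st : store R) : Prop := Arrays {
  arr_tail i : wmem st 6 i = nth 0%N [seq val e.1 | e <- sl] i;
  arr_head i : wmem st 7 i = nth 0%N [seq val e.2 | e <- sl] i;
  arr_per i : wmem st 8 i = nth 0%N [seq Pw e | e <- sl] i;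
  arr_len i : rmem st 5 i = nth 0 [seq len e | e <- sl] i;
  arr_del i : rmem st 6 i = nth 0 [seq d e | e <- sl] i;
  arr_vper v : wmem st 9 v = period Pw sl v }.

Lemma arrays_same sl aw ar st st' :
  all (fun a => a \notin aw) [:: 6; 7; 8; 9]%N ->
  all (fun a => a \notin ar) [:: 5; 6]%N ->
  same aw ar st st' -> arrays sl st -> arrays sl st'.
Proof.
move=> /and5P[w6 w7 w8 w9 _] /and3P[r5 r6 _] [w r] [a1 a2 a3 a4 a5 a6].
by split=> i; rewrite ?w ?r.
Qed.

End SortedArrays.

Section Scales.
Context {R : realType} {n : nat}.
Notation edge := ('I_n * 'I_n)%type.
Variables (B : nat) (s : 'I_n) (sl : seq edge) (Pw : edge -> nat).
Variables (len d : edge -> R) (eps Dmin : R) (h H S : nat).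

Definition time_unit sg : R := eps * (2 ^+ sg * Dmin) / h%:R.
Definition ticks sg e : nat := Num.truncn (d e / time_unit sg).

Record env (st : store R) : Prop := Env {
  env_n : wmem st 0 0 = n;
  env_h : wmem st 0 2 = h;
  env_s : wmem st 0 3 = s;
  env_m : wmem st 10 0 = size sl;
  env_H : wmem st 11 0 = H;
  env_S : wmem st 12 0 = S;
  env_eps : rmem st 0 0 = eps;
  env_Dmin : rmem st 0 1 = Dmin;
  env_arr : arrays Pw len d sl st }.

Lemma env_same aw ar st st' :
  all (fun a => a \notin aw) [:: 0; 6; 7; 8; 9; 10; 11; 12]%N ->
  all (fun a => a \notin ar) [:: 0; 5; 6]%N ->
  same aw ar st st' -> env st -> env st'.
Proof.
move=> aP rP sm [e1 e2 e3 e4 e5 e6 e7 e8 arr].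
have [w r] := sm.
have {}w a : a \in [:: 0; 6; 7; 8; 9; 10; 11; 12]%N -> wmem st' a = wmem st a.
  by move=> ?; apply/w/(allP aP).
have {}r a : a \in [:: 0; 5; 6]%N -> rmem st' a = rmem st a.
  by move=> ?; apply/r/(allP rP).
split; rewrite ?w ?r //.
case: arr => a1 a2 a3 a4 a5 a6.
by split=> i; rewrite ?w ?r.
Qed.

Lemma cell_lt sg v i : (sg <= S)%N -> (v < n)%N -> (i <= H)%N ->
  (@cell n H sg v i < S.+1 * n * H.+1)%N.
Proof.
move=> le_S lt_n le_H; rewrite /cell.
have le1 : ((sg * n + v).+1 <= S.+1 * n)%N.
  rewrite -addnS (leq_trans (leq_add (leqnn _) lt_n)) // -mulSnr.
  by rewrite leq_mul2r ltnS le_S orbT.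
have : ((sg * n + v).+1 * H.+1 <= S.+1 * n * H.+1)%N by rewrite leq_mul2r le1 orbT.
by rewrite mulSn; lia.
Qed.

Hypothesis B_big : (S.+1 * n * H.+1 + H + h + size sl + 4 <= B)%N.

(** Apart from [H + 1], every intermediate value is at most the final index, so the size of the
    table bounds them all. *)
Lemma okw_cell (st : store R) v lvl (w : 'I_n) :
  env st -> (wmem st 17 0 <= S)%N -> okw B st v -> okw B st lvl ->
  valw st v = w -> (valw st lvl <= H)%N ->
  okw B st (cell_exp v lvl) /\
  valw st (cell_exp v lvl) = @cell n H (wmem st 17 0) w (valw st lvl %/ period Pw sl w).
Proof.
move=> En le_S okv okl vE le_H.
rewrite /= !vE (env_n En) (env_H En) (arr_vper (env_arr En)).
have le_i : (valw st lvl %/ period Pw sl w <= H)%N by apply: leq_trans (leq_div _ _) le_H.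
have := cell_lt le_S (ltn_ord w) le_i; rewrite /cell addn1.
set c := (_ %/ _)%N => lt_c; set sg := wmem st 17 0 in le_S lt_c *.
have c2 : ((sg * n + w) <= (sg * n + w) * H.+1)%N by rewrite leq_pmulr.
by split=> //; repeat split=> //; lia.
Qed.

Hypothesis Pw_gt0 : forall e, e \in sl -> (0 < Pw e)%N.
Hypothesis sl_sorted : sorted (fun e f => Pw e %| Pw f)%N sl.
Hypothesis d_ge0 : forall e, e \in sl -> 0 <= d e.
Hypothesis eps_gt0 : 0 < eps.
Hypothesis Dmin_gt0 : 0 < Dmin.
Hypothesis h_gt0 : (0 < h)%N.

Lemma time_unit_gt0 sg : 0 < time_unit sg.
Proof. by rewrite divr_gt0 ?mulr_gt0 ?exprn_gt0 // ltr0n. Qed.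

Lemma wp_relax st e sg j Q :
  env st -> wmem st 17 0 = sg -> (sg <= S)%N -> wmem st 18 0 = j ->
  (0 < j)%N -> (j <= H)%N -> (wmem st 16 0 < size sl)%N ->
  nth (s, s) sl (wmem st 16 0) = e -> (Pw e %| j)%N ->
  rmem st 7 sg = time_unit sg ->
  sound s sl Pw len ticks H (wmem st 22) (rmem st 8) ->
  complete s sl Pw len ticks H sg j (wmem st 22) (rmem st 8) ->
  (forall st', same [:: 19; 20; 21; 22]%N [:: 8]%N st st' ->
     sound s sl Pw len ticks H (wmem st' 22) (rmem st' 8) ->
     lower (wmem st 22) (rmem st 8) (wmem st' 22) (rmem st' 8) ->
     relaxed s sl Pw len ticks H sg j (wmem st' 22) (rmem st' 8) e -> Q st') ->
  wp B relax st Q.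
Proof.
move=> En sgE le_S jE j0 jH k_lt nthE Pj unE snd cmp HQ.
have esl : e \in sl by rewrite -nthE mem_nth.
have pv_gt0 := period_gt0 Pw_gt0 esl.
have pv_j := dvdn_trans (period_dvd sl_sorted esl) Pj.
pose c := @cell n H sg e.2 (j %/ period Pw sl e.2).
have arr := env_arr En.
have E7 : wmem st 7 (wmem st 16 0) = e.2.
  by rewrite (arr_head arr) (nth_map (s, s)) // nthE.
have E6 : wmem st 6 (wmem st 16 0) = e.1.
  by rewrite (arr_tail arr) (nth_map (s, s)) // nthE.
have R5 : rmem st 5 (wmem st 16 0) = len e.
  by rewrite (arr_len arr) (nth_map (s, s)) // nthE.
have R6 : rmem st 6 (wmem st 16 0) = d e.
  by rewrite (arr_del arr) (nth_map (s, s)) // nthE.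
have i_le : (j %/ period Pw sl e.2 <= H)%N by apply: leq_trans (leq_div _ _) jH.
have i_gt0 : (0 < j %/ period Pw sl e.2)%N by rewrite divn_gt0 // dvdn_leq.
have jdiv : (j %/ period Pw sl e.2 * period Pw sl e.2 = j)%N by rewrite divnK.
have c_lt : (c < B)%N.
  by have := cell_lt le_S (ltn_ord e.2) i_le; rewrite /c; lia.
have B0 : (3 < B)%N by lia.
have H_B : (H + 2 < B)%N by lia.
have [B_0 B_1 B_2] : [/\ (0 < B)%N, (1 < B)%N & (2 < B)%N] by clear -H_B; split; lia.
have H_lt : (H < B)%N by clear -H_B; lia.
have cell_ok := @okw_cell; clear B_big.
have c_gt0 : (0 < c)%N by rewrite /c /cell addn_gt0 i_gt0 orbT.
have [okc cE] : okw B st (cell_exp (WGet 7 (reg 16)) (reg 18)) /\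
    valw st (cell_exp (WGet 7 (reg 16)) (reg 18)) = c.
  have := @cell_ok st (WGet 7 (reg 16)) (reg 18) e.2 En.
  by rewrite /= sgE jE; apply.
apply/wp_seq/wp_setreg => //.
move=> st1 sm1; rewrite cE => c1.
apply/wp_seq/wp_setreg => //.
  by rewrite /= c1; split=> //; apply: leq_ltn_trans (leq_subr _ _) c_lt.
move=> st2 sm2 src2; have {}src2 : wmem st2 21 0 = c.-1 by rewrite src2 /= c1 subn1.
have {}c1 : wmem st2 20 0 = c by rewrite (proj1 sm2).
have {}sm2 : same [:: 20; 21]%N [::] st st2.
  by apply: same_trans (same_sub _ _ sm1) (same_sub _ _ sm2).
apply: wp_seq; apply: wp_offer => //.
move=> st3 sm3; rewrite c1 src2 [valr _ _]/= (proj1 sm2) // (proj2 sm2) // => F3 X3.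
have c3 : wmem st3 20 0 = c by rewrite (proj1 sm3).
have {sm2} sm3 : same [:: 20; 21; 22]%N [:: 8]%N st st3.
  exact: same_trans (same_sub _ _ sm2) (same_sub _ _ sm3).
have src_cell : c.-1 = @cell n H sg e.2 (j %/ period Pw sl e.2).-1.
  by rewrite /c /cell -{1}(prednK i_gt0) addnS.
have snd3 : sound s sl Pw len ticks H (wmem st3 22) (rmem st3 8).
  rewrite F3 X3; apply: sound_offer => //.
  rewrite addr0 src_cell => /snd[|a le_a r]; first exact: leq_trans (leq_pred _) i_le.
  by exists a => //; apply: leq_trans le_a _; rewrite leq_mul2r leq_pred orbT.
have low3 : lower (wmem st 22) (rmem st 8) (wmem st3 22) (rmem st3 8).
  by rewrite F3 X3; apply: offer_lower.
have copy3 x : good (wmem st 22) (rmem st 8) c.-1 x ->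
    good (wmem st3 22) (rmem st3 8) c x.
  by move=> g; have := offer_good c 0 g; rewrite addr0 F3 X3.
have {}HQ st' : same [:: 19; 20; 21; 22]%N [:: 8]%N st st' ->
    sound s sl Pw len ticks H (wmem st' 22) (rmem st' 8) ->
    lower (wmem st3 22) (rmem st3 8) (wmem st' 22) (rmem st' 8) ->
    ((ticks sg e < j)%N -> forall x,
      good (wmem st3 22) (rmem st3 8)
        (@cell n H sg e.1 ((j - (ticks sg e).+1) %/ period Pw sl e.1)) x ->
      good (wmem st' 22) (rmem st' 8) c (x + len e)) -> Q st'.
  move=> sm' snd' low' edge'; apply: HQ => //; first exact: lower_trans low'.
  apply: relaxed_offers cmp _ _ => // [x g|lt_j x g].
    by apply: low'; apply: copy3.
  by apply: edge' => //; apply: low3.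
have En3 : env st3 by apply: env_same sm3 En.
have [w3 r3] := sm3.
have R6' : rmem st3 6 (wmem st3 16 0) = d e by rewrite r3 // w3.
have U7' : rmem st3 7 (wmem st3 17 0) = time_unit sg by rewrite r3 // w3 // sgE.
have ugt := time_unit_gt0 sg.
apply: wp_if.
- by [].
- move=> vc; have {vc} le_d : d e <= H%:R * time_unit sg.
    by move: vc; rewrite /= R6' U7' (env_H En3).
  have q_le : (ticks sg e <= H)%N.
    by rewrite truncn_le_nat ltr_pdivrMr // (le_lt_trans le_d) // ltr_pM2r // ltr_nat.
  have q1_B : (ticks sg e + 1 < B)%N by clear -q_le H_B; lia.
  apply: wp_seq; apply: wp_floor => //.
    by rewrite /= R6' U7'; apply: leq_ltn_trans H_lt.
  move=> st4 sm4 q4; have {}q4 : wmem st4 19 0 = ticks sg e by rewrite q4 /= R6' U7'.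
  have [F4 X4] : wmem st4 22 = wmem st3 22 /\ rmem st4 8 = rmem st3 8.
    by rewrite (proj1 sm4) // (proj2 sm4).
  have c4 : wmem st4 20 0 = c by rewrite (proj1 sm4).
  have {}sm4 : same [:: 19; 20; 21; 22]%N [:: 8]%N st st4.
    exact: same_trans (same_sub _ _ sm3) (same_sub _ _ sm4).
  have En4 : env st4 by apply: env_same sm4 En.
  have [w4 r4] := sm4.
  have E17 : wmem st4 17 0 = sg by rewrite w4.
  have E18 : wmem st4 18 0 = j by rewrite w4.
  have E16 : wmem st4 16 0 = wmem st 16 0 by rewrite w4.
  have vlvl : valw st4 (WSub (reg 18) (WAdd (reg 19) (WConst 1))) = (j - (ticks sg e).+1)%N.
    by rewrite /= q4 E18 addn1.
  apply: wp_if.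
  + by rewrite /= q4; do ![split].
  + move=> vc; have {vc} lt_j : (ticks sg e < j)%N by move: vc; rewrite /= q4 E18 addn1.
    have [okc5 cE5] :
      okw B st4 (cell_exp (WGet 6 (reg 16)) (WSub (reg 18) (WAdd (reg 19) (WConst 1)))) /\
      valw st4 (cell_exp (WGet 6 (reg 16)) (WSub (reg 18) (WAdd (reg 19) (WConst 1)))) =
      @cell n H sg e.1 ((j - (ticks sg e).+1) %/ period Pw sl e.1).
      rewrite -vlvl -E17; apply: cell_ok => //; rewrite ?E17 ?vlvl //.
      - rewrite /= q4 E18; do ![split] => //; apply: leq_ltn_trans (leq_subr _ _) _.
        exact: leq_ltn_trans jH H_lt.
      - by rewrite /= E16 w4.
      - exact: leq_trans (leq_subr _ _) jH.
    apply: wp_seq; apply: wp_setreg => //.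
    move=> st5 sm5; rewrite cE5 => src5.
    have [F5 X5] : wmem st5 22 = wmem st4 22 /\ rmem st5 8 = rmem st4 8.
      by rewrite (proj1 sm5) // (proj2 sm5).
    have c5 : wmem st5 20 0 = c by rewrite (proj1 sm5).
    have {}sm5 : same [:: 19; 20; 21; 22]%N [:: 8]%N st st5.
      exact: same_trans (same_sub _ _ sm4) (same_sub _ _ sm5).
    have [w5 r5] := sm5.
    have L5 : valr st5 (RGet 5 (reg 16)) = len e by rewrite /= r5 // w5.
    apply: wp_offer => //.
    move=> st6 sm6; rewrite c5 src5 L5 F5 X5 F4 X4 => F6 X6.
    apply: HQ.
    * exact: same_trans sm5 (same_sub _ _ sm6).
    * rewrite F6 X6; apply: sound_offer => // /snd3[|a le_a r].
        exact: leq_trans (leq_div _ _) (leq_trans (leq_subr _ _) jH).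
      (* The offered walk has arrived by level [j - ticks - 1], hence it may end the edge exactly at
         [j], waiting if it is early. *)
      exists j; first by rewrite jdiv.
      apply: reach_edge r _ _ => //.
      have := leq_trans le_a (leq_trunc_div _ _).
      by move: lt_j; clear; lia.
    * by rewrite F6 X6; apply: offer_lower.
    * by move=> _ x g; rewrite F6 X6; apply: offer_good.
  + move=> vc; have {vc} ge_j : (j <= ticks sg e)%N.
      by move: vc; rewrite /= q4 E18 addn1 -ltnNge ltnS.
    by apply: HQ; rewrite ?F4 ?X4 // ltnNge ge_j.
(* When the guard fails, the truncated delay is at least [H >= j], so no walk can end this edge at
   level [j]. *)
- move=> vc; have {vc} lt_d : H%:R * time_unit sg < d e.
    by move: vc; rewrite /= R6' U7' (env_H En3) -ltNge.
  apply: HQ => //; first exact: same_sub sm3.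
  move=> lt_j; exfalso.
  suff /(leq_trans jH) : (H <= ticks sg e)%N by rewrite leqNgt lt_j.
  rewrite truncn_ge_nat; last by rewrite divr_ge0 ?d_ge0 // ltW.
  by rewrite ler_pdivlMr // ltW.
Qed.

End Scales.

(** * Correctness and cost of the loops over edges, levels and scales *)

Section Loops.
Context {R : realType} {n : nat}.
Notation edge := ('I_n * 'I_n)%type.
Variables (B : nat) (s : 'I_n) (sl : seq edge) (Pw : edge -> nat).
Variables (len d : edge -> R) (eps Dmin : R) (h H S : nat).
Notation tick := (time_unit eps Dmin h).
Notation ticks := (ticks d eps Dmin h).
Notation env := (env s sl Pw len d eps Dmin h H S).

Hypothesis B_big : (S.+1 * n * H.+1 + H + h + size sl + 4 <= B)%N.
Hypothesis Pw_gt0 : forall e, e \in sl -> (0 < Pw e)%N.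
Hypothesis Pw_le : forall e, e \in sl -> (Pw e <= h)%N.
Hypothesis sl_sorted : sorted (fun e f => Pw e %| Pw f)%N sl.
Hypothesis d_ge0 : forall e, e \in sl -> 0 <= d e.
Hypothesis eps_gt0 : 0 < eps.
Hypothesis Dmin_gt0 : 0 < Dmin.
Hypothesis h_gt0 : (0 < h)%N.
Hypothesis sl_gt0 : (0 < size sl)%N.

Notation snd st := (sound s sl Pw len ticks H (wmem st 22) (rmem st 8)).
Notation cmpl sg j st := (complete s sl Pw len ticks H sg j (wmem st 22) (rmem st 8)).
Notation lwr st st' := (lower (wmem st 22) (rmem st 8) (wmem st' 22) (rmem st' 8)).
Notation P0 := (head 0%N [seq Pw e | e <- sl]).

Definition active j : nat := find (fun e => ~~ (Pw e %| j)%N) sl.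

Lemma active_le j : (active j <= size sl)%N.
Proof. exact: find_size. Qed.

Lemma active_dvd j k : (k < active j)%N -> (Pw (nth (s, s) sl k) %| j)%N.
Proof. by move=> /(before_find (s, s))/negbFE. Qed.

(** Along the sorted list each period divides the later ones, so an edge that is not due at [j]
    rules out all edges after it. Stopping at the first such edge misses nothing. *)
Lemma dvd_active j k : (k < size sl)%N -> (Pw (nth (s, s) sl k) %| j)%N ->
  (k < active j)%N.
Proof.
move=> k_lt Pj; rewrite ltnNge; apply/negP => le_k.
have lt_a : (active j < size sl)%N by lia.
have := lt_a; rewrite /active -has_find => /(nth_find (s, s)) /negP; apply.
apply: dvdn_trans Pj; apply: (sorted_leq_nth _ _ _ sl_sorted) => //.
by move=> ? ? ?; apply: dvdn_trans.
Qed.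

Lemma P0_gt0 : (0 < P0)%N.
Proof. by case: sl sl_gt0 Pw_gt0 => //= e l _; apply; rewrite mem_head. Qed.

Lemma P0_le : (P0 <= h)%N.
Proof. by case: sl sl_gt0 Pw_le => //= e l _; apply; rewrite mem_head. Qed.

Definition relax_steps : nat := (steps (Seq relax (incr 16))).+1.

Lemma run_level_loop st0 sg j :
  env st0 -> wmem st0 17 0 = sg -> (sg <= S)%N -> wmem st0 18 0 = j ->
  (0 < j)%N -> (j <= H)%N -> (P0 %| j)%N -> wmem st0 16 0 = 0%N ->
  rmem st0 7 sg = tick sg -> snd st0 -> cmpl sg j st0 ->
  run B level_loop st0 (relax_steps * active j).+1 (fun st =>
    [/\ same [:: 16; 19; 20; 21; 22]%N [:: 8]%N st0 st, snd st, lwr st0 st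
      & cmpl sg (j + P0) st]).
Proof.
move=> En0 sgE le_S jE j0 jH P0j k0 unE snd0 cmp0.
pose I k st := [/\ (k <= active j)%N, wmem st 16 0 = k,
  same [:: 16; 19; 20; 21; 22]%N [:: 8]%N st0 st, snd st /\ lwr st0 st
  & forall k', (k' < k)%N ->
    relaxed s sl Pw len ticks H sg j (wmem st 22) (rmem st 8) (nth (s, s) sl k')].
have IE k st : I k st -> env st /\ wmem st 18 0 = j /\ wmem st 17 0 = sg.
  move=> [_ _ sm _ _]; split; first exact: env_same sm En0.
  by rewrite !(proj1 sm).
have := @run_while _ B (CAnd (CNot (CLeW (reg 10) (reg 16)))
              (CLeW (WMod (reg 18) (WGet 8 (reg 16))) (WConst 0)))
  (Seq relax (incr 16)) I (fun=> steps (Seq relax (incr 16))) (active j) st0.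
move=> W; apply: run_imp (W _ _ _) _ _ => {W}.
- by split=> //; split=> // c x.
- move=> k st Ik; have [En [jE' _]] := IE _ _ Ik; case: Ik => le_a kE _ _ _.
  rewrite /= kE (env_m En) jE' (arr_per (env_arr En)); split.
    have : (j %% nth 0 [seq Pw e | e <- sl] k <= j)%N by apply: leq_mod.
    by do ![split]; lia.
  have [lt_k|ge_k] := ltnP k (size sl); last first.
    by apply/esym/negbTE; rewrite -leqNgt (leq_trans (active_le j)).
  rewrite /= (nth_map (s, s)) // leqn0 -/(dvdn _ _).
  apply/idP/idP => [|/active_dvd//]; exact: dvd_active.
- move=> k st lt_a Ik; have [En [jE' sgE']] := IE _ _ Ik.
  case: Ik => le_a kE sm [snd_ low] rel.
  have lt_k : (k < size sl)%N by apply: leq_trans lt_a (active_le j).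
  apply: run_wp; apply: wp_seq.
  have cmp := complete_lower low cmp0.
  apply: (wp_relax B_big Pw_gt0 sl_sorted d_ge0 eps_gt0 Dmin_gt0 h_gt0
    En sgE' le_S jE' j0 jH _ (erefl _) _ _ snd_ cmp); rewrite ?kE //.
    exact: active_dvd.
    by rewrite (proj2 sm).
  move=> st1 sm1 snd1 low1 rel1.
  have [w1 r1] := sm1; have k1 : wmem st1 16 0 = k by rewrite w1.
  have sm1' : same [:: 16; 19; 20; 21; 22]%N [:: 8]%N st0 st1.
    exact: same_trans sm (same_sub _ _ sm1).
  apply: wp_setreg; [lia|by rewrite /= k1; do ![split]; lia|].
  move=> st2 sm2; rewrite /= k1 addn1 => k2.
  have [F2 X2] : wmem st2 22 = wmem st1 22 /\ rmem st2 8 = rmem st1 8.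
    by rewrite (proj1 sm2) // (proj2 sm2).
  split=> //.
  - exact: same_trans sm1' (same_sub _ _ sm2).
  - by rewrite F2 X2; split=> //; apply: lower_trans low1.
  - move=> k'; rewrite F2 X2 ltnS leq_eqVlt => /orP[/eqP->|/rel].
      exact: rel1.
    exact: relaxed_lower.
- by rewrite sum_nat_const card_ord mulnC.
- move=> st [_ _ sm [snd_ low] rel]; split=> //.
  apply: complete_level => //; first exact: P0_gt0.
    exact: complete_lower cmp0.
  move=> e esl Pe; rewrite -(nth_index (s, s) esl); apply: rel.
  by apply: dvd_active; rewrite ?index_mem ?nth_index.
Qed.

(* Amortization: between consecutive multiples of [P0], the quotient by [Pw e]
   grows at least when [Pw e] divides the new level. *)
Lemma sum_active :
  (\sum_(i < H %/ P0) active (i.+1 * P0) <= \sum_(e <- sl) H %/ Pw e)%N.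
Proof.
have le1 j : (0 < j)%N -> (active j <= \sum_(e <- sl) (Pw e %| j))%N.
  move=> j0; rewrite /active; elim: sl => //= e l IH.
  by rewrite big_cons; case: (Pw e %| j)%N.
apply: (@leq_trans (\sum_(i < H %/ P0) \sum_(e <- sl) (Pw e %| i.+1 * P0)%N)).
  by apply: leq_sum => i _; apply: le1; rewrite muln_gt0 P0_gt0.
rewrite exchange_big /= big_seq [leqRHS]big_seq; apply: leq_sum => e esl.
apply: leq_trans (leq_div2r (Pw e) (leq_divM H P0)).
elim: (H %/ P0)%N => [|N IH]; first by rewrite big_ord0.
rewrite big_ord_recr /=; apply: leq_trans (leq_add IH (leqnn _)) _.
have P0' := P0_gt0; have Pe := Pw_gt0 esl.
case dvd : (_ %| _)%N => /=; last by rewrite addn0 leq_div2r // leq_mul2r leqnSn orbT.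
have /dvdnP[k kE] := dvd; rewrite kE mulnK // addn1 ltn_divLR // -kE ltn_mul2r.
by rewrite P0' ltnSn.
Qed.

Definition work : nat := (\sum_(e <- sl) H %/ Pw e)%N.

Lemma head_work : (H %/ P0 <= work)%N.
Proof.
by rewrite /work; case: sl sl_gt0 => //= e l _; rewrite big_cons leq_addr.
Qed.

(** Iteration [i] treats level [i.+1 * P0]. The overhead of 4 steps per level is absorbed by [work],
    because the first edge alone, of period [P0], accounts for as many relaxations as there are
    levels. *)
Lemma run_scale_loop st0 sg :
  env st0 -> wmem st0 17 0 = sg -> (sg <= S)%N -> wmem st0 18 0 = P0 ->
  rmem st0 7 sg = tick sg -> snd st0 -> cmpl sg P0 st0 ->
  run B scale_loop st0 ((relax_steps + 4) * work).+1 (fun st =>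
    [/\ same [:: 16; 18; 19; 20; 21; 22]%N [:: 8]%N st0 st, snd st, lwr st0 st
      & cmpl sg H.+1 st]).
Proof.
move=> En0 sgE le_S jE unE snd0 cmp0; have P0' := P0_gt0; have P0h := P0_le.
pose I i st := [/\ (i <= H %/ P0)%N, wmem st 18 0 = (i.+1 * P0)%N,
  same [:: 16; 18; 19; 20; 21; 22]%N [:: 8]%N st0 st, snd st /\ lwr st0 st
  & cmpl sg (i.+1 * P0) st].
have IE i st : I i st -> env st.
  by move=> [_ _ sm _ _]; apply: env_same sm En0.
have := @run_while _ B (CLeW (reg 18) (reg 11))
  (Seq (setreg 16 (WConst 0)) (Seq level_loop (setreg 18 (WAdd (reg 18) (WGet 8 (WConst 0))))))
  I (fun i => 1 + ((relax_steps * active (i.+1 * P0)).+1 + 1))%N (H %/ P0) st0.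
move=> W; apply: run_imp (W _ _ _) _ _ => {W}.
- by split; rewrite ?mul1n //; split=> // c x.
- move=> i st Ii; have En := IE _ _ Ii; case: Ii => le_i jE' _ _ _.
  rewrite /= jE' (env_H En); split; first by do ![split]; lia.
  by rewrite leq_divRL.
- move=> i st lt_i Ii; have En := IE _ _ Ii; case: Ii => le_i jE' sm [snd_ low] cmp.
  have jH : (i.+1 * P0 <= H)%N by rewrite -leq_divRL.
  apply: run_seq; apply: run_wp; apply: wp_setreg => //=; try lia.
  move=> st1 sm1 k1; apply: run_seq.
  have [w1 r1] := sm1.
  have En1 : env st1 by apply: env_same sm1 En.
  have w17 : wmem st1 17 0 = sg by rewrite w1 // (proj1 sm).
  have w18 : wmem st1 18 0 = (i.+1 * P0)%N by rewrite w1.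
  have r7 : rmem st1 7 sg = tick sg by rewrite r1 // (proj2 sm).
  have w22 : wmem st1 22 = wmem st 22 by rewrite w1.
  have r8 : rmem st1 8 = rmem st 8 by rewrite r1.
  rewrite -w22 -r8 in snd_ low cmp.
  have jP : (P0 %| i.+1 * P0)%N by rewrite dvdn_mull.
  have j_gt0 : (0 < i.+1 * P0)%N by rewrite muln_gt0.
  apply: run_imp (run_level_loop En1 w17 le_S w18 j_gt0 jH jP k1 r7 snd_ cmp) (leqnn _) _.
  move=> st2 [sm2 snd2 low2 cmp2]; apply: run_wp.
  have j2 : wmem st2 18 0 = (i.+1 * P0)%N by rewrite (proj1 sm2).
  have {}sm2 : same [:: 16; 18; 19; 20; 21; 22]%N [:: 8]%N st0 st2.
    apply: same_trans sm (same_trans (same_sub _ _ sm1) (same_sub _ _ sm2)) => //.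
  have p2 : wmem st2 8 0 = P0.
    rewrite (proj1 sm2) // (arr_per (env_arr En0)) nth0 //.
  (* The level counter overshoots [H] by at most [P0 <= h], for which [B_big] has room. *)
  apply: wp_setreg; [lia|by rewrite /= j2 p2; do ![split]; lia|].
  move=> st3 sm3; rewrite /= j2 p2 => j3.
  have [F3 X3] : wmem st3 22 = wmem st2 22 /\ rmem st3 8 = rmem st2 8.
    by rewrite (proj1 sm3) // (proj2 sm3).
  split=> //; rewrite ?F3 ?X3.
  + by rewrite j3 -mulSnr.
  + exact: same_trans sm2 (same_sub _ _ sm3).
  + by split=> //; apply: lower_trans low2.
  + by rewrite mulSnr.
- rewrite ltnS (eq_bigr (fun i : 'I__ => relax_steps * active (i.+1 * P0) + 4)%N);
    last by move=> *; lia.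
  rewrite big_split /= -big_distrr /= sum_nat_const card_ord.
  rewrite mulnDl leq_add ?leq_mul2l ?sum_active ?orbT // mulnC leq_mul2l head_work orbT //.
- move=> st [_ _ sm [snd_ low] cmp]; split=> // v a x j' r aj' j'lt j'H.
  have lt_j : (j' < (H %/ P0).+1 * P0)%N := leq_ltn_trans j'H (ltn_ceil H P0').
  exact: cmp r aj' lt_j j'H.
Qed.

Lemma wp_scale_init st sg Q :
  env st -> wmem st 17 0 = sg -> (sg <= S)%N -> rmem st 9 0 = 2 ^+ sg * Dmin ->
  (forall st', same [:: 18; 20; 22]%N [:: 7; 8]%N st st' ->
     wmem st' 22 = write (wmem st 22) (@cell n H sg s 0) 1%N ->
     rmem st' 8 = write (rmem st 8) (@cell n H sg s 0) 0 ->
     rmem st' 7 = write (rmem st 7) sg (tick sg) ->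
     wmem st' 18 0 = P0 -> Q st') ->
  wp B scale_init st Q.
Proof.
move=> En sgE le_S D9 HQ.
have B3 : (3 < B)%N by lia.
have c_lt := cell_lt le_S (ltn_ord s) (leq0n H).
have cE : ((sg * n + s) * (H + 1))%N = @cell n H sg s 0 by rewrite /cell addn0 addn1.
have row_le : (sg * n + s <= @cell n H sg s 0)%N by rewrite -cE addn1 leq_pmulr.
have [[eh es] eH] := (env_h En, env_s En, env_H En).
have eP : wmem st 8 0 = P0 by rewrite (arr_per (env_arr En)) nth0.
apply: wp_seq; apply: wp_setr; [by rewrite /=; lia|by rewrite /=; lia|].
move=> st1 [w1 r1]; rewrite [valw _ _]/= sgE [valr _ _]/= (env_eps En) D9 eh => U1.
apply: wp_seq; apply: wp_setreg; first by lia.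
  by rewrite /= !w1 // sgE (env_n En) es eH cE; do ![split]; lia.
move=> st2 [w2 r2]; rewrite [valw _ _]/= !w1 // sgE (env_n En) es eH cE => c2.
apply: wp_seq; apply: wp_setw; [by rewrite /=; lia|by rewrite /=; lia|].
move=> st3 [w3 r3]; rewrite [valw _ (reg _)]/= c2 w2 // w1 // => F3.
apply: wp_seq; apply: wp_setr; [by rewrite /=; lia|by rewrite /=; lia|].
move=> st4 [w4 r4]; rewrite [valw _ _]/= w3 // c2 r3 // r2 // r1 // => X4.
apply: wp_setreg; [lia|by rewrite /=; lia|].
move=> st5 [w5 r5]; rewrite [valw _ _]/= w4 // w3 // w2 // w1 // eP => P5.
apply: HQ => //.
- split=> a na.
    by rewrite w5 ?w4 ?w3 ?w2 ?w1 //; apply: contra na; rewrite !inE => /eqP->.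
  by rewrite r5 ?r4 ?r3 ?r2 ?r1 //; apply: contra na; rewrite !inE => /eqP->.
- by rewrite w5 // w4.
- by rewrite r5.
- by rewrite r5 // r4 // r3 // r2.
Qed.

Definition scale_steps : nat := (relax_steps + 4) * work + steps scale_init + 4.

Lemma run_all_scales st0 :
  env st0 -> wmem st0 17 0 = 0%N -> wmem st0 22 =1 (fun=> 0%N) ->
  run B all_scales st0 (S.+1 * scale_steps + 2) (fun st =>
    [/\ same [:: 16; 17; 18; 19; 20; 21; 22]%N [:: 7; 8; 9]%N st0 st, snd st
      & forall sg, (sg <= S)%N -> cmpl sg H.+1 st /\ rmem st 7 sg = tick sg]).
Proof.
move=> En0 sg0 F0.
pose I i st := [/\ (i <= S.+1)%N, wmem st 17 0 = i /\ rmem st 9 0 = 2 ^+ i * Dmin,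
  same [:: 16; 17; 18; 19; 20; 21; 22]%N [:: 7; 8; 9]%N st0 st, snd st
  & forall sg, (sg < i)%N -> cmpl sg H.+1 st /\ rmem st 7 sg = tick sg].
have IE i st : I i st -> env st.
  by move=> [_ _ sm _ _]; apply: env_same sm En0.
have B1 : (S.+3 < B)%N.
  have := ltn_ord s; have : (S.+1 <= S.+1 * n * H.+1)%N.
    by rewrite -mulnA leq_pmulr // muln_gt0 andbT (leq_ltn_trans _ (ltn_ord s)).
  by lia.
rewrite addn2 -add1n; apply: run_seq; apply: run_wp; apply: wp_setr; [by rewrite /=; lia..|].
move=> st1 [w1 r1]; rewrite [valr _ _]/= (env_Dmin En0) => D1.
have := @run_while _ B (CLeW (reg 17) (reg 12))
  (Seq scale_init (Seq scale_loop (Seq (incr 17) (SetR 9 (WConst 0) (RAdd (rreg 9) (rreg 9))))))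
  I (fun=> steps scale_init + (((relax_steps + 4) * work).+1 + 2))%N S.+1 st1.
move=> W; apply: run_imp (W _ _ _) _ _ => {W}.
- split=> //.
  + by rewrite w1 // sg0 D1 /write eqxx expr0 mul1r.
  + by split=> a na; rewrite ?w1 ?r1 //; apply: contra na; rewrite !inE => /eqP->.
  + by move=> sg v i _; rewrite w1 // F0.
- move=> i st Ii; have En := IE _ _ Ii; case: Ii => le_i [iE _] _ _ _.
  by rewrite /= iE (env_S En); split=> //; lia.
- move=> i st lt_i Ii; have En := IE _ _ Ii.
  case: Ii => le_i [iE Di] sm snd_ done.
  apply: run_seq; apply: run_wp; apply: (wp_scale_init En iE lt_i Di).
  move=> st2 sm2 F2 X2 U2 P2; apply: run_seq.
  have En2 : env st2 by apply: env_same sm2 En.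
  have i2 : wmem st2 17 0 = i by rewrite (proj1 sm2).
  have U2' : rmem st2 7 i = tick i by rewrite U2 /write eqxx.
  have snd2 : snd st2 by rewrite F2 X2; apply: sound_write (reach0 _ _ _ _ _).
  (* Writing 0 raises no entry: by soundness, an entry already set there belongs to a walk arriving
     at level 0, which has length 0. *)
  have low2 : lwr st st2.
    move=> c x [Fc Xc]; rewrite F2 X2 /good /write; case: eqP => // cE; split=> //.
    move: Fc Xc; rewrite cE => /snd_[//|a]; rewrite mul0n leqn0 => /eqP a0 r.
    by have [_ ->] := reach_le0 r a0.
  have cmp2 : cmpl i P0 st2.
    by apply: complete_init => //; [exact: P0_gt0|rewrite F2 X2 /good /write eqxx].
  apply: run_imp (run_scale_loop En2 i2 lt_i P2 U2' snd2 cmp2) (leqnn _) _.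
  move=> st3 [sm3 snd3 low3 cmp3]; apply: run_wp.
  have i3 : wmem st3 17 0 = i by rewrite (proj1 sm3).
  have D3 : rmem st3 9 0 = 2 ^+ i * Dmin by rewrite (proj2 sm3) // (proj2 sm2).
  have U3 : rmem st3 7 = rmem st2 7 by rewrite (proj2 sm3).
  apply: wp_seq; apply: wp_setreg; [lia|by rewrite /= i3; do ![split]; lia|].
  move=> st4 sm4; rewrite [valw _ _]/= i3 addn1 => i4.
  apply: wp_setr; [by rewrite /=; lia..|].
  move=> st5 sm5; rewrite /= (proj2 sm4) // D3 => D5.
  have [F5 X5] : wmem st5 22 = wmem st3 22 /\ rmem st5 8 = rmem st3 8.
    by rewrite (proj1 sm5) // (proj1 sm4) // (proj2 sm5) // (proj2 sm4).
  have U5 : rmem st5 7 = rmem st2 7 by rewrite (proj2 sm5) // (proj2 sm4).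
  split=> //; rewrite ?F5 ?X5 ?U5 //.
  + split; first by rewrite (proj1 sm5) // i4.
    by rewrite D5 /write eqxx exprS -mulrA mulrDl mul1r.
  + apply: same_trans sm _.
    apply: same_trans (same_sub _ _ sm2) _ => //.
    apply: same_trans (same_sub _ _ sm3) _ => //.
    by apply: same_trans (same_sub _ _ sm4) (same_sub _ _ sm5).
  + move=> sg; rewrite ltnS leq_eqVlt => /orP[/eqP->|lt_sg]; first by [].
    have [cmp_sg U_sg] := done _ lt_sg; split.
      exact: complete_lower low3 (complete_lower low2 cmp_sg).
    by rewrite U2 /write (ltn_eqF lt_sg).
- by rewrite sum_nat_const card_ord /scale_steps; lia.
- by move=> st [_ _ sm snd_ done]; split.
Qed.

End Loops.

(** * Sorting the edges by period *)

Lemma nth_write_rcons (T : Type) (x0 x : T) (s : seq T) i :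
  write (nth x0 s) (size s) x i = nth x0 (rcons s x) i.
Proof.
rewrite /write nth_rcons; case: ltngtP => // lt_i.
by rewrite nth_default // ltnW.
Qed.

Section Sort.
Context {R : realType} {n : nat}.
Notation edge := ('I_n * 'I_n)%type.
Variables (B h : nat) (len d : edge -> R) (freq : edge -> nat).

Definition level e : nat := trunc_log 2 (freq e).
Definition pow_period e : nat := (2 ^ level e)%N.

Definition bucket (us : seq edge) a := [seq e <- us | level e == a].
Definition buckets us a := flatten [seq bucket us i | i <- iota 0 a].

Lemma bucketsS us a : buckets us a.+1 = buckets us a ++ bucket us a.
Proof. by rewrite /buckets -addn1 iotaD map_cat flatten_cat /= cats0. Qed.

Lemma mem_buckets us a e : (e \in buckets us a) = (level e < a)%N && (e \in us).
Proof.
elim: a => [|a IH] //; rewrite bucketsS mem_cat IH mem_filter ltnS [in RHS]leq_eqVlt.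
by case: (e \in us); rewrite ?andbT ?andbF // orbC.
Qed.

(** Periods are equal within a bucket, and exponents increase from one bucket to the next. *)
Lemma buckets_sorted us a :
  sorted (fun e f => pow_period e %| pow_period f)%N (buckets us a).
Proof.
have tr : transitive (fun e f => pow_period e %| pow_period f)%N.
  by move=> ? ? ?; apply: dvdn_trans.
rewrite (sorted_pairwise tr).
have le_dvd e f : (level e <= level f)%N -> (pow_period e %| pow_period f)%N.
  by move=> le; apply: dvdn_exp2l.
elim: a => // a IH; rewrite bucketsS pairwise_cat IH /=.
apply/andP; split.
  apply/allrelP => e f; rewrite mem_buckets mem_filter => /andP[lt_e _] /andP[/eqP fE _].
  by apply: le_dvd; rewrite fE ltnW.
have: all (fun e => level e == a) (bucket us a) by apply: filter_all.
elim: (bucket us a) => //= e l IHl /andP[/eqP eE la]; rewrite IHl // andbT.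
by apply: sub_all la => f /eqP fE; apply: le_dvd; rewrite eE fE.
Qed.

(** Each edge lies in exactly one bucket. In this form the fact yields both the size of the sorted
    list and the bound on [work]. *)
Lemma sum_buckets us a (f : edge -> nat) :
  (forall e, e \in us -> level e < a)%N ->
  (\sum_(e <- buckets us a) f e = \sum_(e <- us) f e)%N.
Proof.
move=> lt_a; rewrite /buckets big_flatten big_map.
under eq_bigr do rewrite big_filter big_mkcond.
rewrite exchange_big /= [LHS]big_seq [RHS]big_seq; apply: eq_bigr => e /lt_a lt_e.
rewrite -big_mkcond /= (eq_bigl (fun i => i == level e)) => [|i]; last by rewrite eq_sym.
have -> : iota 0 a = index_iota 0 a by rewrite /index_iota subn0.
by rewrite (big_nat1_eq _ (fun=> f e)) lt_e.
Qed.

Lemma size_buckets us a :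
  (forall e, e \in us -> level e < a)%N -> size (buckets us a) = size us.
Proof. by move=> lt_a; rewrite -!sum1_size sum_buckets. Qed.

Lemma wp_append (st : store R) cur e k Q :
  (size cur + 2 <= B)%N ->
  arrays pow_period len d cur st -> wmem st 15 0 = size cur -> wmem st 16 0 = k ->
  wmem st 14 0 = pow_period e -> wmem st 1 k = e.1 -> wmem st 2 k = e.2 ->
  rmem st 1 k = len e -> rmem st 2 k = d e ->
  (forall st', same [:: 6; 7; 8; 9; 15]%N [:: 5; 6]%N st st' ->
    arrays pow_period len d (rcons cur e) st' -> wmem st' 15 0 = (size cur).+1 -> Q st') ->
  wp B append_edge st Q.
Proof.
move=> Bbig [a1 a2 a3 a4 a5 a6] cE kE pE tE hE lE dE HQ.
have B0 : (1 < B)%N by lia.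
apply: wp_seq; apply: wp_setw; [by rewrite /=; lia|by rewrite /=; lia|].
move=> st1 [w1 r1]; rewrite [valw _ _]/= cE [valw _ (WGet 1 _)]/= kE tE => e1.
apply: wp_seq; apply: wp_setw; [by rewrite /=; lia|by rewrite /=; lia|].
move=> st2 [w2 r2]; rewrite [valw _ _]/= [valw _ (WGet 2 _)]/= !w1 // cE kE hE => e2.
apply: wp_seq; apply: wp_setw; [by rewrite /=; lia|by rewrite /=; lia|].
move=> st3 [w3 r3]; rewrite [valw _ _]/= [valw _ (reg 14)]/= !w2 // !w1 // cE pE => e3.
apply: wp_seq; apply: wp_setr; [by rewrite /=; lia|by rewrite /=; lia|].
move=> st4 [w4 r4]; rewrite [valw _ _]/= [valr _ _]/= !w3 // !w2 // !w1 //.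
rewrite r3 // r2 // r1 // r3 // r2 // r1 // cE kE lE => e4.
apply: wp_seq; apply: wp_setr; [by rewrite /=; lia|by rewrite /=; lia|].
move=> st5 [w5 r5]; rewrite [valw _ _]/= [valr _ _]/= !w4 // !w3 // !w2 // !w1 //.
rewrite !r4 // !r3 // !r2 // !r1 // cE kE dE => e5.
apply: wp_seq.
have w51 a : a \notin [:: 6; 7; 8]%N -> wmem st5 a = wmem st a.
  rewrite !inE !negb_or => /and3P[n6 n7 n8].
  by rewrite w5 // w4 // w3 ?w2 ?w1 // inE.
have h5 : wmem st5 2 (wmem st5 16 0) = e.2 by rewrite !w51 // kE hE.
have fin st6 : same [:: 9]%N [::] st5 st6 ->
    (forall v, wmem st6 9 v = period pow_period (rcons cur e) v) ->
    wp B (incr 15) st6 Q.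
  move=> [w6 r6] per6.
  have c6 : wmem st6 15 0 = size cur by rewrite w6 // w51.
  apply: wp_setreg => //; first by lia.
    by rewrite /= c6; do ![split]; lia.
  move=> st7 [w7 r7]; rewrite /= c6 addn1 => c7.
  apply: HQ => //.
    split=> a; rewrite !inE !negb_or => na.
      by rewrite w7 ?w6 ?w51 // !inE ?negb_or; case/and5P: na => *; do ?[apply/and3P; split].
    by case/andP: na => *; rewrite r7 ?r6 ?r5 ?r4 ?r3 ?r2 ?r1 ?inE.
  split=> i.
  - rewrite map_rcons -nth_write_rcons size_map.
    by rewrite w7 // w6 // w5 // w4 // w3 // w2 // e1 /write a1.
  - rewrite map_rcons -nth_write_rcons size_map.
    by rewrite w7 // w6 // w5 // w4 // w3 // e2 /write a2.
  - rewrite map_rcons -nth_write_rcons size_map.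
    by rewrite w7 // w6 // w5 // w4 // e3 /write a3.
  - rewrite map_rcons -nth_write_rcons size_map.
    by rewrite r7 // r6 // r5 // e4 /write a4.
  - rewrite map_rcons -nth_write_rcons size_map.
    by rewrite r7 // r6 // e5 /write a5.
  - by rewrite w7.
have P_gt0 e' : e' \in cur -> (0 < pow_period e')%N by rewrite expn_gt0.
apply: wp_if; first by rewrite /=; lia.
  move=> vc; have {vc} per0 : period pow_period cur e.2 = 0%N.
    by move: vc; rewrite /= h5 w51 // a6 leqn0 => /eqP.
  apply: wp_setw; [by rewrite /=; lia|by rewrite /=; lia|].
  move=> st6 sm6; rewrite [valw _ _]/= [valw _ (reg 14)]/= h5 !w51 // pE => e6.
  apply: fin => // v; rewrite e6 period_rcons // /write a6.
  by case: eqP => [->|] //; rewrite per0.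
move=> vc; have {vc} per0 : period pow_period cur e.2 != 0%N.
  by move: vc; rewrite /= h5 w51 // a6 leqn0.
apply: fin => // v; rewrite period_rcons // w51 // a6.
by case: eqP => [->|] //; rewrite (negbTE per0).
Qed.

Lemma run_count_edges (st0 : store R) (es : seq edge) :
  (size es + 3 <= B)%N -> wmem st0 0 1 = size es -> wmem st0 0 2 = h ->
  (forall i, wmem st0 3 i = nth 0%N [seq freq e | e <- es] i) -> wmem st0 10 0 = 0%N ->
  let m := find (fun e => h < freq e)%N es in
  run B count_edges st0 (m * 2).+1 (fun st =>
    same [:: 10]%N [::] st0 st /\ wmem st 10 0 = m).
Proof.
move=> Bbig mE hE fE k0 m.
pose I k st := [/\ (k <= m)%N, same [:: 10]%N [::] st0 st & wmem st 10 0 = k].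
have le_m : (m <= size es)%N by apply: find_size.
have := @run_while _ B (CAnd (CNot (CLeW numE (reg 10))) (CLeW (WGet 3 (reg 10)) budget))
  (incr 10) I (fun=> 1)%N m st0.
move=> W; apply: run_imp (W _ _ _) _ _ => {W}.
- by split.
- move=> k st [le_k [w r] kE].
  rewrite /= kE !w // mE hE fE; split; first by do ![split]; lia.
  have [lt_k|ge_k] := leqP (size es) k.
    by apply/esym/negbTE; rewrite -leqNgt (leq_trans le_m).
  case e0 : es ge_k => [|e0' es'] // ge_k.
  rewrite (nth_map e0') //= -e0.
  have [lt_km|] := ltnP k m.
    by rewrite leqNgt (before_find e0' lt_km).
  move=> ge_km; have {ge_km le_k} kE' : k = m by lia.
  rewrite -{}e0 in ge_k; have := ge_k; rewrite kE' -has_find => /(nth_find e0').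
  by rewrite -/m ltnNge => /negbTE.
- move=> k st lt_k [le_k [w r] kE]; apply: run_wp.
  apply: wp_setreg; [lia|by rewrite /= kE; do ![split]; lia|].
  move=> st1 [w1 r1]; rewrite /= kE addn1 => k1.
  split=> //; split=> a na; first by rewrite w1 // w.
  by rewrite r1 // r.
- by rewrite sum_nat_const card_ord.
- by move=> st [].
Qed.

Lemma size_buckets_le us a b : (a <= b)%N ->
  (size (buckets us a) <= size (buckets us b))%N.
Proof.
move=> /subnKC <-; elim: (b - a)%N => [|c IH]; first by rewrite addn0.
by rewrite addnS bucketsS size_cat (leq_trans IH) // leq_addr.
Qed.

Variables (e0 : edge) (us : seq edge).
Hypothesis us_le : forall e, e \in us -> (freq e <= h)%N.
Hypothesis h_gt0 : (0 < h)%N.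
Hypothesis B_big : (size us + h + h + 3 <= B)%N.

Notation A := (trunc_log 2 h).

Record unsorted (st : store R) : Prop := Unsorted {
  uns_h : wmem st 0 2 = h;
  uns_m : wmem st 10 0 = size us;
  uns_tail k : (k < size us)%N -> wmem st 1 k = (nth e0 us k).1;
  uns_head k : (k < size us)%N -> wmem st 2 k = (nth e0 us k).2;
  uns_freq k : (k < size us)%N -> wmem st 3 k = freq (nth e0 us k);
  uns_len k : (k < size us)%N -> rmem st 1 k = len (nth e0 us k);
  uns_del k : (k < size us)%N -> rmem st 2 k = d (nth e0 us k) }.

Lemma unsorted_same st st' :
  same [:: 6; 7; 8; 9; 13; 14; 15; 16]%N [:: 5; 6]%N st st' ->
  unsorted st -> unsorted st'.
Proof. by move=> [w r] [u1 u2 u3 u4 u5 u6 u7]; split; rewrite ?w ?r. Qed.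

Lemma level_le e : e \in us -> (level e < A.+1)%N.
Proof. by move=> /us_le le_h; rewrite ltnS leq_trunc_log. Qed.

Lemma pow_le a : (a <= A)%N -> (2 ^ a <= h)%N /\ (a < h)%N.
Proof.
move=> le_a; have le1 : (2 ^ a <= h)%N.
  by apply: leq_trans (trunc_logP (isT : (1 < 2)%N) h_gt0); rewrite leq_exp2l.
by split=> //; apply: leq_trans (ltn_expl a _) le1.
Qed.

Definition sort_steps : nat := (steps sort_body).+1.

Lemma run_bucket st0 a :
  unsorted st0 -> (a <= A)%N -> wmem st0 13 0 = a -> wmem st0 14 0 = (2 ^ a)%N ->
  wmem st0 16 0 = 0%N -> wmem st0 15 0 = size (buckets us a) ->
  arrays pow_period len d (buckets us a) st0 ->
  run B (While (CNot (CLeW (reg 10) (reg 16))) sort_body) st0 (size us * sort_steps).+1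
    (fun st => [/\ same [:: 6; 7; 8; 9; 15; 16]%N [:: 5; 6]%N st0 st,
       wmem st 15 0 = size (buckets us a.+1)
     & arrays pow_period len d (buckets us a.+1) st]).
Proof.
move=> un0 le_a a0 p0 k0 c0 arr0.
have [pa_le a_lt] := pow_le le_a.
pose cur k := buckets us a ++ [seq e <- take k us | level e == a].
have curS : cur (size us) = buckets us a.+1 by rewrite /cur take_size bucketsS.
have cur_le k : (size (cur k) <= size us)%N.
  apply: (@leq_trans (size (buckets us A.+1))); last by rewrite size_buckets // => e /level_le.
  apply: leq_trans (size_buckets_le us (_ : a.+1 <= A.+1)%N) => //.
  rewrite bucketsS /cur !size_cat leq_add2l /bucket -[in leqRHS](cat_take_drop k us).
  by rewrite filter_cat size_cat leq_addr.
pose I k st := [/\ (k <= size us)%N, same [:: 6; 7; 8; 9; 15; 16]%N [:: 5; 6]%N st0 st,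
  wmem st 16 0 = k, wmem st 15 0 = size (cur k) & arrays pow_period len d (cur k) st].
have := @run_while _ B (CNot (CLeW (reg 10) (reg 16))) sort_body I
  (fun=> steps sort_body) (size us) st0.
move=> W; apply: run_imp (W _ _ _) _ _ => {W}.
- by split; rewrite /cur ?take0 ?cats0.
- move=> k st [le_k [w r] kE _ _].
  by rewrite /= kE w // (uns_m un0) -ltnNge; split=> //; lia.
- move=> k st lt_k [le_k sm kE cE arr]; apply: run_wp.
  have un : unsorted st by apply: unsorted_same un0; apply: same_sub sm.
  set e := nth e0 us k; have eus : e \in us by apply: mem_nth.
  have lv_lt := level_le eus.
  have aE : wmem st 13 0 = a by rewrite (proj1 sm).
  have pE : wmem st 14 0 = (2 ^ a)%N by rewrite (proj1 sm).
  have cur1 : cur k.+1 = if level e == a then rcons (cur k) e else cur k.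
    rewrite /cur (take_nth e0) // filter_rcons -/e.
    by case: ifP => // _; rewrite rcons_cat.
  have fin st1 : same [:: 6; 7; 8; 9; 15]%N [:: 5; 6]%N st st1 ->
      wmem st1 15 0 = size (cur k.+1) -> arrays pow_period len d (cur k.+1) st1 ->
      wp B (incr 16) st1 (I k.+1).
    move=> sm1 c1 arr1; have k1 : wmem st1 16 0 = k by rewrite (proj1 sm1).
    apply: wp_setreg; [lia|by rewrite /= k1; do ![split]; lia|].
    move=> st2 sm2; rewrite /= k1 addn1 => k2; split=> //.
    - by apply: same_trans sm (same_trans (same_sub _ _ sm1) (same_sub _ _ sm2)).
    - by rewrite (proj1 sm2).
    - exact: arrays_same sm2 arr1.
  have [pA aA] := pow_le (lv_lt : (level e <= A)%N).
  apply: wp_seq; apply: wp_if.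
  + rewrite /= kE (uns_freq un) // -/(level e).
    by do ![split]; lia.
  + move=> vc; have {vc} lvE : level e = a.
      by move: vc; rewrite /= aE kE (uns_freq un) // -/(level _) -eqn_leq => /eqP.
    rewrite lvE eqxx in cur1.
    apply: (wp_append (e := e) _ arr cE kE) => //.
    * by have := cur_le k; lia.
    * by rewrite pE /pow_period lvE.
    * exact: uns_tail.
    * exact: uns_head.
    * exact: uns_len.
    * exact: uns_del.
    move=> st1 sm1 arr1 c1; apply: fin => //; rewrite ?cur1 //.
    by rewrite c1 size_rcons.
  + move=> vc; have {vc} lvE : (level e == a) = false.
      by move: vc; rewrite /= aE kE (uns_freq un) // -/(level _) -eqn_leq eq_sym => /negbTE.
    by rewrite lvE in cur1; apply: fin; rewrite ?cur1.
- by rewrite sum_nat_const card_ord.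
- by move=> st [_ sm _ cE arr]; rewrite curS in cE arr; split.
Qed.

Lemma run_sort_edges st0 :
  unsorted st0 -> wmem st0 13 0 = 0%N -> wmem st0 15 0 = 0%N ->
  arrays pow_period len d [::] st0 ->
  run B sort_edges st0 (A.+1 * (size us * sort_steps + 5) + 2)
    (fun st => same [:: 6; 7; 8; 9; 13; 14; 15; 16]%N [:: 5; 6]%N st0 st /\
       arrays pow_period len d (buckets us A.+1) st).
Proof.
move=> un0 a0 c0 arr0.
rewrite addn2 -add1n; apply: run_seq; apply: run_wp.
apply: wp_setreg; [lia|by rewrite /=; lia|].
move=> st1 sm1 /= p1.
pose I a st := [/\ (a <= A.+1)%N, same [:: 6; 7; 8; 9; 13; 14; 15; 16]%N [:: 5; 6]%N st0 st,
  wmem st 13 0 = a /\ wmem st 14 0 = (2 ^ a)%N, wmem st 15 0 = size (buckets us a)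
  & arrays pow_period len d (buckets us a) st].
have := @run_while _ B (CLeW (reg 13) (WLog2 budget))
  (Seq (setreg 16 (WConst 0))
    (Seq (While (CNot (CLeW (reg 10) (reg 16))) sort_body)
         (Seq (incr 13) (setreg 14 (WMul (reg 14) (WConst 2))))))
  I (fun=> 1 + ((size us * sort_steps).+1 + 2))%N A.+1 st1.
have [pA ltA] := pow_le (leqnn A).
move=> W; apply: run_imp (W _ _ _) _ _ => {W}.
- split=> //.
  + exact: same_sub sm1.
  + by rewrite p1 (proj1 sm1).
  + by rewrite (proj1 sm1).
  + exact: arrays_same sm1 arr0.
- move=> a st [le_a [w r] [aE _] _ _].
  by rewrite /= aE !w // (uns_h un0) ltnS; split=> //; do ![split]; lia.
- move=> a st lt_a [le_a sm [aE pE] cE arr].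
  have [pa_le a_lt] := pow_le (lt_a : (a <= A)%N).
  apply: run_seq; apply: run_wp; apply: wp_setreg; [lia|by rewrite /=; lia|].
  move=> st2 sm2 /= k2; apply: run_seq.
  have {}sm2' : same [:: 6; 7; 8; 9; 13; 14; 15; 16]%N [:: 5; 6]%N st0 st2.
    exact: same_trans sm (same_sub _ _ sm2).
  have un2 := unsorted_same sm2' un0.
  have [w2 r2] := sm2.
  have arr2 : arrays pow_period len d (buckets us a) st2 by apply: arrays_same sm2 arr.
  have a2 : wmem st2 13 0 = a by rewrite w2.
  have p2 : wmem st2 14 0 = (2 ^ a)%N by rewrite w2.
  have c2 : wmem st2 15 0 = size (buckets us a) by rewrite w2.
  apply: run_imp (run_bucket un2 lt_a a2 p2 k2 c2 arr2) (leqnn _) _.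
  move=> st3 [sm3 c3 arr3]; apply: run_wp.
  have a3 : wmem st3 13 0 = a by rewrite (proj1 sm3).
  have p3 : wmem st3 14 0 = (2 ^ a)%N by rewrite (proj1 sm3).
  apply: wp_seq; apply: wp_setreg; [lia|by rewrite /= a3; do ![split]; lia|].
  move=> st4 sm4; rewrite [valw _ _]/= a3 addn1 => a4.
  have p4 : wmem st4 14 0 = (2 ^ a)%N by rewrite (proj1 sm4).
  apply: wp_setreg; [lia|by rewrite /= p4; do ![split]; lia|].
  move=> st5 sm5; rewrite /= p4 => p5; split=> //.
  + apply: same_trans sm2' _; apply: same_trans (same_sub _ _ sm3) _ => //.
    by apply: same_trans (same_sub _ _ sm4) (same_sub _ _ sm5).
  + by rewrite (proj1 sm5) // a4 p5 expnSr.
  + by rewrite (proj1 sm5) // (proj1 sm4).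
  + by apply: arrays_same sm5 _ => //; apply: arrays_same sm4 arr3.
- by rewrite sum_nat_const card_ord; lia.
- by move=> st [].
Qed.

End Sort.

(** * Correctness of a lookup *)

Section Prefix.
Context {n : nat}.
Notation edge := ('I_n * 'I_n)%type.
Variables (E : {set edge}) (freq : edge -> nat) (h : nat) (es : seq edge).
Hypothesis es_list : edge_listing E freq h es.

Definition usable : seq edge := take (find (fun e => h < freq e)%N es) es.

Lemma size_usable : size usable = find (fun e => h < freq e)%N es.
Proof. by rewrite size_take_min; apply/minn_idPl/find_size. Qed.

Lemma usable_sub e : e \in usable -> e \in E.
Proof.
by move=> /mem_take; have [/perm_mem-> _] := es_list; rewrite mem_enum.
Qed.

Lemma usable_le e : e \in usable -> (freq e <= h)%N.
Proof.
move=> /(nthP e)[i]; rewrite size_usable => lt_i <-.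
by rewrite nth_take // leqNgt (before_find e lt_i).
Qed.

(** The relation in [edge_listing] is a preorder, so it passes from neighbours to any two positions:
    an edge of frequency at most [h] cannot come after one of larger frequency. *)
Lemma mem_usable e : e \in E -> (freq e <= h)%N -> e \in usable.
Proof.
move=> eE le_h; have [/perm_mem es_E es_sorted] := es_list.
have ees : e \in es by rewrite es_E mem_enum.
have lt_e : (index e es < size es)%N by rewrite index_mem.
have tr : transitive (fun e f => (freq f <= h)%N ==> (freq e <= h)%N).
  by move=> f g k /implyP fg /implyP gk; apply/implyP => /gk/fg.
have re : reflexive (fun e f => (freq f <= h)%N ==> (freq e <= h)%N).
  by move=> f; apply/implyP.
suff lt_i : (index e es < find (fun e => h < freq e)%N es)%N.
  rewrite -(nth_index e ees) -(nth_take e lt_i).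
  by apply: mem_nth; rewrite size_usable.
rewrite ltnNge; apply/negP => le_i.
have lt_m := leq_ltn_trans le_i lt_e.
have := lt_m; rewrite -has_find => /(nth_find e); rewrite ltnNge => /negP; apply.
have := sorted_leq_nth tr re e es_sorted _ _ lt_m lt_e le_i.
by rewrite /= nth_index // le_h.
Qed.

End Prefix.

Section Lookup.
Context {R : realType} {n : nat}.
Notation edge := ('I_n * 'I_n)%type.
Variables (E : {set edge}) (ell d : edge -> R) (freq : edge -> nat) (sl : seq edge).
Variables (eps Dmin : R) (h H : nat) (s : 'I_n).
Notation Pw := (pow_period freq).
Notation tick := (time_unit eps Dmin h).
Notation ticks := (ticks d eps Dmin h).

Hypothesis ell_ge0 : forall e, e \in E -> 0 <= ell e.
Hypothesis d_ge0 : forall e, e \in E -> 0 <= d e.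
Hypothesis freq_gt0 : forall e, e \in E -> (0 < freq e)%N.
Hypothesis slE : {subset sl <= E}.
Hypothesis sl_mem : forall e, e \in E -> (freq e <= h)%N -> e \in sl.
Hypothesis eps_gt0 : 0 < eps.
Hypothesis Dmin_gt0 : 0 < Dmin.
Hypothesis h_gt0 : (0 < h)%N.

Lemma pow_period_gt0 e : (0 < Pw e)%N.
Proof. by rewrite expn_gt0. Qed.

Lemma pow_period_le e : e \in E -> (Pw e <= freq e)%N.
Proof. by move=> /freq_gt0 f0; apply: trunc_logP. Qed.

(** By soundness the entry is the length of a walk arriving by level [L]. Cutting its cycles gives a
    simple walk that is no longer and no later, and completeness bounds the entry by the length of
    that one; so the entry is exactly the length of a simple path. The [h] added to the level makes
    room for the rounding on any path of frequency at most [h]. It costs [h] units of delay, that is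
    [eps * 2 ^+ sg * Dmin <= eps * D]. *)
Lemma lookup_valid F X sg (t : 'I_n) (D : R) :
  sound s sl Pw ell ticks H F X -> complete s sl Pw ell ticks H sg H.+1 F X ->
  0 < D -> 2 ^+ sg * Dmin <= D -> (Num.truncn (D / tick sg) + h <= H)%N ->
  let c := @cell n H sg t ((Num.truncn (D / tick sg) + h) %/ period Pw sl t) in
  valid_answer E ell d freq h eps s t D (if F c == 0%N then +oo%E else (X c)%:E).
Proof.
move=> snd cmp D0 sgD LH; set L := (_ + h)%N in LH *; move=> c.
have LH1 : (L < H.+1)%N := LH.
have ugt := @time_unit_gt0 _ eps Dmin h eps_gt0 Dmin_gt0 h_gt0 sg.
have Du0 : 0 <= D / tick sg by apply: divr_ge0; exact: ltW.
have ell_sl e : e \in sl -> 0 <= ell e by move=> /slE/ell_ge0.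
have d_sl e : e \in sl -> 0 <= d e by move=> /slE/d_ge0.
have lower_bound p : is_path E s t p -> (path_freq freq s p <= h)%N ->
    path_weight d s p <= D -> good F X c (path_weight ell s p).
  move=> [Ep pt _] fr del.
  have P0 e : e \in sl -> (0 < Pw e)%N by move=> _; apply: pow_period_gt0.
  have P1 e : e \in sl -> (Pw e <= freq e)%N by move=> /slE; apply: pow_period_le.
  have [a [r le_a]] := path_reach ell ugt d_sl (fun=> erefl (ticks sg _)) sl_mem P0 P1 Ep fr.
  rewrite pt in r; apply: cmp r _ LH1 LH.
  rewrite /L addnC -leq_subLR truncn_ge_nat //.
  have [le_ha|lt_ah] := leqP h a; last by rewrite (eqP (ltnW lt_ah)).
  rewrite natrB // lerBlDr (le_trans le_a) // lerD ?ler_nat //.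
  by rewrite ler_pM2r ?invr_gt0.
have [F0|F0] := eqVneq (F c) 0%N.
  right; split=> //; rewrite /rdist [X in ereal_inf X](_ : _ = set0) ?ereal_inf0 //.
  apply/seteqP; split=> // x [p [pp fr del] _].
  by have [] := lower_bound _ pp fr del; rewrite F0.
left.
have i_le : (L %/ period Pw sl t <= H)%N by apply: leq_trans (leq_div _ _) LH.
have [|a le_a r] := snd sg t _ i_le; first by rewrite lt0n.
have [p [a' [x [sr le_a' le_x]]]] := reach_simple ell_sl r.
have aL : (a' <= L)%N.
  by apply: leq_trans le_a' (leq_trans le_a (leq_trunc_div _ _)).
have [pp xE] := simple_reach_is_path slE sr.
have [_ Xx] : good F X c x.
  exact: cmp (simple_reach_reach sr) aL LH1 LH.
have XE : X c = path_weight ell s p by apply: le_anti; rewrite -xE le_x Xx.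
exists p; split=> //; first by rewrite XE.
- rewrite -XE; apply: le_ereal_inf_tmp => _ [p' [pp' fr' del'] <-].
  by rewrite lee_fin; have [] := lower_bound _ pp' fr' del'.
- apply: le_trans (simple_reach_delay ugt (fun e => erefl (ticks sg e)) sr) _.
  have Du : (Num.truncn (D / tick sg))%:R <= D / tick sg.
    by rewrite truncn_le.
  have hu : h%:R * tick sg = eps * (2 ^+ sg * Dmin).
    by rewrite /time_unit mulrC divfK // pnatr_eq0 -lt0n.
  have LD : L%:R * tick sg <= D + eps * (2 ^+ sg * Dmin).
    by rewrite natrD mulrDl hu lerD2r -ler_pdivlMr.
  apply: (@le_trans _ _ (L%:R * tick sg)); first by rewrite ler_pM2r // ler_nat.
  by rewrite (le_trans LD) // mulrDl mul1r lerD2l ler_pM2l.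
Qed.

Lemma source_valid (D : R) : 0 < D ->
  valid_answer E ell d freq h eps s s D 0%:E.
Proof.
move=> D0; left; exists [::].
have w0 (w : edge -> R) : path_weight w s [::] = 0 by rewrite /path_weight big_nil.
rewrite !w0; split=> //.
- apply: le_ereal_inf_tmp => _ [p' [[Ep _ _] _ _] <-]; rewrite lee_fin.
  elim/last_ind: p' Ep => [|p v IH]; first by rewrite w0.
  rewrite rcons_path path_weight_rcons => /andP[/IH le /ell_ge0 le'].
  exact: addr_ge0.
- by rewrite mulr_ge0 ?addr_ge0 // ltW.
Qed.

(** A path to [t != s] has a last edge, and within the frequency budget that edge would be in
    [sl]. *)
Lemma unreachable_valid (t : 'I_n) (D : R) : t != s -> sl = [::] ->
  valid_answer E ell d freq h eps s t D +oo%E.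
Proof.
move=> ts sl0; right; split=> //; rewrite /rdist [X in ereal_inf X](_ : _ = set0) ?ereal_inf0 //.
apply/seteqP; split=> // x [p [[Ep pt _] fr _] _].
case/lastP: p Ep pt fr => [_ /= st|p v]; first by rewrite st eqxx in ts.
rewrite rcons_path path_freq_rcons => /andP[_ eE] _ le_h.
have : (last s p, v) \in sl by apply: (sl_mem eE); apply: leq_trans le_h; apply: leq_addl.
by rewrite sl0.
Qed.

End Lookup.

(** * The complete preprocessing and query programs *)

Section Assembly.
Context {R : realType} {n : nat}.
Notation edge := ('I_n * 'I_n)%type.
Variables (E : {set edge}) (ell d : edge -> R) (freq : edge -> nat) (es : seq edge).
Variables (eps Dmin Dmax : R) (h : nat) (s : 'I_n) (B : nat).

Notation Pw := (pow_period freq).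
Notation us := (usable freq h es).
Notation sl := (buckets freq us (trunc_log 2 h).+1).
Notation st0 := (input_store ell d freq es eps Dmin Dmax h s).

(** A query uses the scale with [2 ^+ sg * Dmin <= D <= 2 ^+ sg.+1 * Dmin], so [D] amounts to at
    most [2 * h / eps] units; the further [h] levels are for rounding. *)
Definition num_levels : nat := (Num.truncn (2%:R * h%:R / eps) + h)%N.
Definition top_scale : nat := trunc_log 2 (Num.truncn (Dmax / Dmin)).
Notation H := num_levels.
Notation S := top_scale.

Hypothesis ell_ge0 : forall e, e \in E -> 0 <= ell e.
Hypothesis d_ge0 : forall e, e \in E -> 0 <= d e.
Hypothesis freq_gt0 : forall e, e \in E -> (0 < freq e)%N.
Hypothesis eps_gt0 : 0 < eps.
Hypothesis Dmin_gt0 : 0 < Dmin.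
Hypothesis h_gt0 : (0 < h)%N.
Hypothesis es_list : edge_listing E freq h es.
Hypothesis B_table : (S.+1 * n * H.+1 + H + h + h + size es + 4 <= B)%N.
Hypothesis B_ratio : (Num.truncn (Dmax / Dmin) < B)%N.

Notation env := (env s sl Pw ell d eps Dmin h H S).
Notation snd st := (sound s sl Pw ell (ticks d eps Dmin h) H (wmem st 22) (rmem st 8)).
Notation cmpl sg st :=
  (complete s sl Pw ell (ticks d eps Dmin h) H sg H.+1 (wmem st 22) (rmem st 8)).

(** The first alternative is the early exit: without usable edges the time bound may be a constant,
    too small for going through the scales. *)
Definition ready (st : store R) : Prop :=
  (us = [::] /\ same [:: 10]%N [::] st0 st) \/
  [/\ env st, snd st & forall sg, (sg <= S)%N ->
     cmpl sg st /\ rmem st 7 sg = time_unit eps Dmin h sg].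

Lemma usable_level e : e \in us -> (level freq e < (trunc_log 2 h).+1)%N.
Proof. by move=> /(usable_le)le_h; rewrite ltnS leq_trunc_log. Qed.

Lemma mem_sl e : (e \in sl) = (e \in us).
Proof.
by rewrite mem_buckets; case eus: (e \in us); rewrite ?andbF // usable_level.
Qed.

Lemma slE : {subset sl <= E}.
Proof. by move=> e; rewrite mem_sl; apply: usable_sub es_list _. Qed.

Lemma size_sl : size sl = size us.
Proof. by apply: size_buckets => e; apply: usable_level. Qed.

Definition bounds_steps := steps set_bounds.

Definition pre_steps : nat :=
  ((size us * 2).+1 + (bounds_steps +
    (((trunc_log 2 h).+1 * (size us * sort_steps + 5) + 2) +
     (S.+1 * scale_steps sl Pw H + 2))).+1)%N.

Lemma run_preprocess :
  run B preprocess st0 (if us is [::] then 3 else pre_steps) ready.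
Proof.
have sz_us : (size us <= size es)%N by rewrite size_usable find_size.
apply: (@run_imp _ _ _ _ ((size us * 2).+1 + (if us is [::] then 2 else
  (bounds_steps + (((trunc_log 2 h).+1 * (size us * sort_steps + 5) + 2) +
     (S.+1 * scale_steps sl Pw H + 2))).+1)) _ ready) => //; last first.
  by rewrite /pre_steps; case: (us).
have n_gt0 : (0 < n)%N by apply: leq_ltn_trans (ltn_ord s).
have S_lt : (S.+1 <= S.+1 * n * H.+1)%N by rewrite -mulnA leq_pmulr // muln_gt0 n_gt0.
apply: run_seq.
have := @run_count_edges R n B h freq st0 es.
rewrite -size_usable => C.
apply: run_imp (C _ erefl erefl (fun=> erefl) erefl) (leqnn _) _; first by lia.
move=> st1 [sm1 m1]; have [w1 r1] := sm1.
case us_nil: (us) => [|e1 us'].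
  apply: run_if; first by rewrite /=; lia.
  rewrite /= m1 us_nil /=; apply: run_wp; left.
  by split.
have us_gt0 : (0 < size us)%N by rewrite us_nil.
rewrite -us_nil; apply: run_if; first by rewrite /=; lia.
have -> : valc st1 (CLeW (reg 10) (WConst 0)) = false by rewrite /= m1 leqNgt us_gt0.
apply: run_seq; apply: run_wp; apply: wp_seq.
apply: wp_floor; [lia|by rewrite /=; lia| |].
  have -> : valr st1 (RDiv (RMul (RofW (WConst 2)) (RofW budget)) (rreg 0)) =
      2%:R * h%:R / eps by rewrite /= w1 // r1.
  by apply: leq_ltn_trans (leq_addr h _) _; rewrite -/num_levels; lia.
move=> st2 [w2 r2]; rewrite [valr _ _]/= w1 // r1 // => H2.
have {}H2 : wmem st2 11 0 = Num.truncn (2%:R * h%:R / eps) by [].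
have b2 : wmem st2 0 2 = h by rewrite w2 // w1.
apply: wp_seq; apply: wp_setreg; first by lia.
  rewrite /= H2 b2; do ![split]; try lia.
  by rewrite -/num_levels; lia.
move=> st3 [w3 r3]; rewrite [valw _ _]/= H2 b2 => H3.
have {}H3 : wmem st3 11 0 = H by [].
apply: wp_seq; apply: wp_floor; [lia|by rewrite /=; lia| |].
  by rewrite /= r3 // r2 // r1.
move=> st4 [w4 r4]; rewrite [valr _ _]/= r3 // r2 // r1 // => S4.
have {}S4 : wmem st4 12 0 = Num.truncn (Dmax / Dmin) by [].
apply: wp_setreg; first by lia.
  by rewrite /= S4 -/top_scale; split; lia.
move=> st5 [w5 r5]; rewrite [valw _ _]/= S4 -/top_scale => S5.
have w50 a : a \notin [:: 10; 11; 12]%N -> wmem st5 a = wmem st0 a.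
  rewrite !inE !negb_or => /and3P[? ? ?].
  by rewrite w5 ?w4 ?w3 ?w2 ?w1 ?inE.
have r50 a : rmem st5 a = rmem st0 a by rewrite r5 ?r4 ?r3 ?r2 ?r1.
have H5 : wmem st5 11 0 = H by rewrite w5 // w4.
have m5 : wmem st5 10 0 = size us by rewrite w5 // w4 // w3 // w2 // m1 size_usable.
have B_sort : (size us + h + h + 3 <= B)%N by lia.
have us_le e : e \in us -> (freq e <= h)%N by apply: usable_le.
have nth_us k : (k < size us)%N -> (k < size es)%N /\ nth (s, s) us k = nth (s, s) es k.
  by move=> lt_k; split; [lia|rewrite nth_take // -size_usable].
have un5 : unsorted h ell d freq (s, s) us st5.
  split; rewrite ?m5 ?w50 ?r50 // => k /nth_us[lt_k ->] /=.
  1-5: by rewrite (nth_map (s, s)).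
have arr5 : arrays Pw ell d [::] st5.
  by split=> i; rewrite ?w50 ?r50 ?nth_nil.
apply: run_seq.
have a5 : wmem st5 13 0 = 0%N by rewrite w50.
have c5 : wmem st5 15 0 = 0%N by rewrite w50.
apply: run_imp (run_sort_edges us_le h_gt0 B_sort un5 a5 c5 arr5) (leqnn _) _.
move=> st6 [[w6 r6] arr6].
have env6 : env st6.
  by split; rewrite ?w6 ?r6 // ?size_sl ?m5 ?H5 ?S5 ?w50 ?r50.
have B6 : (S.+1 * n * H.+1 + H + h + size sl + 4 <= B)%N by rewrite size_sl; lia.
have sl_gt0 : (0 < size sl)%N by rewrite size_sl.
have P0 e : e \in sl -> (0 < Pw e)%N by move=> _; apply: pow_period_gt0.
have P1 e : e \in sl -> (Pw e <= h)%N.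
  rewrite mem_sl => eus; apply: leq_trans (usable_le eus).
  by apply: pow_period_le (usable_sub es_list eus).
have d0 e : e \in sl -> 0 <= d e by move=> /slE/d_ge0.
have sg6 : wmem st6 17 0 = 0%N by rewrite w6 // w50.
have F6 : wmem st6 22 =1 (fun=> 0%N) by move=> i; rewrite w6 // w50.
have srt := buckets_sorted freq us (trunc_log 2 h).+1.
apply: run_imp (run_all_scales B6 P0 P1 srt d0 eps_gt0 Dmin_gt0 h_gt0 sl_gt0
  env6 sg6 F6) (leqnn _) _.
move=> st7 [sm7 snd7 cmp7]; right; split=> //.
exact: env_same sm7 env6.
Qed.

Lemma run_query st (t : 'I_n) (D : R) : ready st -> Dmin <= D <= Dmax ->
  run B query (query_store st t D) (steps query)
    (fun st' => valid_answer E ell d freq h eps s t D (answer st')).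
Proof.
move=> rdy /andP[leD Dle]; have D0 : 0 < D by apply: lt_le_trans leD.
have S_lt : (S.+1 <= S.+1 * n * H.+1)%N.
  by rewrite -mulnA leq_pmulr // muln_gt0 (leq_ltn_trans _ (ltn_ord s)).
have [B0 B1 B2 B3] : [/\ (0 < B)%N, (1 < B)%N, (2 < B)%N & (3 < B)%N] by split; lia.
have [S_B HB] : (S < B)%N /\ (H + h < B)%N by split; lia.
have table_B : (S.+1 * n * H.+1 < B)%N by lia.
apply: run_wp; set st1 := query_store st t D.
have sm1 : same [:: 4]%N [:: 3]%N st st1 by apply: same_setr => //; apply: same_setw.
have [w1 r1] := sm1.
have [hE sE DE] : [/\ wmem st1 0 2 = h, wmem st1 0 3 = s & rmem st1 0 1 = Dmin].
  rewrite w1 // r1 //; case: rdy => [[_ [w r]]|[En _ _]].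
    by rewrite w // r.
  by rewrite (env_h En) (env_s En) (env_Dmin En).
have tE : wmem st1 4 0 = t by [].
have DD : rmem st1 3 0 = D by [].
clearbody st1.
apply: wp_if; first by [].
  move=> vc; have {vc} ts : t = s.
    by apply: val_inj => /=; move: vc; rewrite /= tE sE -eqn_leq => /eqP.
  split; [exact: B0|exact: B1|]; split; [exact: B0|exact: B0|].
  by rewrite /answer /= ts; apply: source_valid.
move=> vc; have {vc} ts : t != s.
  by apply: contraNneq vc => ts; rewrite /= sE tE ts leqnn.
have ratio_le : (Num.truncn (D / Dmin) <= Num.truncn (Dmax / Dmin))%N.
  by apply: le_truncn; rewrite ler_pM2r // invr_gt0.
have ratio_ge1 : 1 <= D / Dmin by rewrite ler_pdivlMr // mul1r.
have ratio_gt0 : (0 < Num.truncn (D / Dmin))%N by rewrite truncn_gt0.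
pose sg := trunc_log 2 (Num.truncn (D / Dmin)).
have sg_le : (sg <= S)%N by apply: leq_trunc_log.
have sgD : 2 ^+ sg * Dmin <= D.
  rewrite -ler_pdivlMr //; apply: (@le_trans _ _ (Num.truncn (D / Dmin))%:R).
    by rewrite -natrX ler_nat trunc_logP.
  by rewrite truncn_le (le_trans _ ratio_ge1).
have Dsg : D <= 2 ^+ sg.+1 * Dmin.
  rewrite -ler_pdivrMr //; apply: le_trans (ltW (truncnS_gt _)) _.
  by rewrite -natrX ler_nat trunc_log_ltn.
apply: wp_seq; apply: wp_floor => //.
  by rewrite [valr _ _]/= DD DE; apply: leq_ltn_trans ratio_le B_ratio.
move=> st2 [w2 r2]; rewrite [valr _ _]/= DD DE => e2.
apply: wp_seq; apply: wp_setreg => //.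
  by rewrite /= e2 -/sg; split=> //; apply: leq_ltn_trans sg_le S_B.
move=> st3 [w3 r3]; rewrite [valw _ _]/= e2 -/sg => e3.
have D3 : valr st3 (RDiv (rreg 3) (RGet 7 (reg 17))) = D / rmem st 7 sg.
  by rewrite /= e3 r3 // r2 // r3 // r2 // DD r1.
have finish st4 c : same [:: 17; 19; 20]%N [::] st1 st4 -> wmem st4 20 0 = c ->
    valid_answer E ell d freq h eps s t D
      (if wmem st 22 c == 0%N then +oo%E else (rmem st 8 c)%:E) ->
    wp B (Seq (SetW 5 (WConst 0) (WGet 22 (reg 20))) (SetR 4 (WConst 0) (RGet 8 (reg 20))))
      st4 (fun st' => valid_answer E ell d freq h eps s t D (answer st')).
  move=> [w4 r4] c4 va; split; [exact: B0|exact: B0|]; split; [exact: B0|exact: B0|].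
  by rewrite /answer /= /upd /= c4 w4 // r4 // w1 // r1.
have sm3 : same [:: 17; 19; 20]%N [::] st1 st3.
  split=> a; rewrite !inE ?negb_or => na; last by rewrite r3 ?r2.
  by case/and3P: na => ? ? ?; rewrite w3 ?w2 ?inE.
case: rdy => [[us_nil [w0 r0]]|[En snd_ cmp]].
  (* After the early exit no unit is stored. The division by 0 gives 0, and the address computed
     below leads to an unset flag, hence to the answer +oo. *)
  have U0 : rmem st 7 sg = 0 by rewrite r0.
  apply: wp_seq; apply: wp_floor => //.
    by rewrite D3 U0 invr0 mulr0 truncn0.
  move=> st4 sm4; rewrite D3 U0 invr0 mulr0 truncn0 => e4.
  have sg4 : wmem st4 17 0 = sg by rewrite (proj1 sm4).
  have {}sm4 : same [:: 17; 19; 20]%N [::] st1 st4.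
    exact: same_trans sm3 (same_sub _ _ sm4).
  have [F0 H0 nE p0] : [/\ wmem st4 22 = wmem st0 22, wmem st4 11 0 = 0%N,
      wmem st4 0 0 = n & wmem st4 9 t = 0%N].
    by rewrite !(proj1 sm4) // !w1 // !w0.
  have t4 : wmem st4 4 0 = t by rewrite (proj1 sm4).
  have h4 : wmem st4 0 2 = h by rewrite (proj1 sm4).
  have cE : valw st4 (cell_exp (WGet 4 (WConst 0)) (WAdd (reg 19) budget)) = (sg * n + t)%N.
    by rewrite /= t4 H0 nE p0 sg4 divn0 addn0 muln1.
  have := @cell_lt n H S sg t 0 sg_le (ltn_ord t) (leq0n _); rewrite /cell addn0 => c_lt.
  have c_le : (sg * n + t <= (sg * n + t) * H.+1)%N by rewrite leq_pmulr.
  apply: wp_seq; apply: wp_setreg => //.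
    rewrite /= t4 H0 nE p0 sg4 e4 h4 divn0 add0n muln1 addn0.
    have h_B : (h < B)%N by apply: leq_ltn_trans (leq_addl _ _) HB.
    have t_B := leq_ltn_trans c_le (ltn_trans c_lt table_B).
    have n_B := leq_ltn_trans (leq_addr t _) t_B.
    by do ![split].
  move=> st5 sm5 c5; apply: finish c5 _.
    exact: same_trans sm4 (same_sub _ _ sm5).
  rewrite w0 //=; apply: (@unreachable_valid R n E ell d freq us) => // e eE le_h.
  exact: (mem_usable es_list eE).
have U : rmem st 7 sg = time_unit eps Dmin h sg by have [] := cmp _ sg_le.
have L_le : (Num.truncn (D / time_unit eps Dmin h sg) + h <= H)%N.
  rewrite leq_add2r; apply: le_truncn; rewrite /time_unit.
  have x0 : 0 < 2 ^+ sg * Dmin by rewrite mulr_gt0 ?exprn_gt0.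
  have h0 : 0 < h%:R :> R by rewrite ltr0n.
  move: Dsg; rewrite exprS -mulrA; set x := 2 ^+ sg * Dmin in x0 * => Dx.
  rewrite invf_div mulrA ler_pdivrMr ?mulr_gt0 //.
  have -> : 2 * h%:R / eps * (eps * x) = (2 * x) * h%:R by field; rewrite gt_eqF.
  by rewrite ler_pM2r.
apply: wp_seq; apply: wp_floor => //.
  rewrite D3 U; apply: leq_ltn_trans HB.
  apply: leq_trans (leq_addr h _) (leq_trans L_le (leq_addr h _)).
move=> st4 sm4; rewrite D3 U => e4.
have sg4 : wmem st4 17 0 = sg by rewrite (proj1 sm4).
have {}sm4 : same [:: 17; 19; 20]%N [::] st1 st4.
  exact: same_trans sm3 (same_sub _ _ sm4).
have En4 : env st4 by apply: env_same sm4 _ => //; apply: env_same sm1 En.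
have lvlE : valw st4 (WAdd (reg 19) budget) = (Num.truncn (D / time_unit eps Dmin h sg) + h)%N.
  by rewrite /= e4 (env_h En4).
have B6 : (S.+1 * n * H.+1 + H + h + size sl + 4 <= B)%N.
  move: B_table; rewrite size_sl size_usable; have := find_size (fun e => h < freq e)%N es.
  by clear; lia.
have t4 : wmem st4 4 0 = t by rewrite (proj1 sm4).
have [] := okw_cell (v := WGet 4 (WConst 0)) (lvl := WAdd (reg 19) budget) (w := t) B6 En4.
- by rewrite sg4.
- by [].
- rewrite /= e4 (env_h En4); do ![split] => //.
  exact: leq_ltn_trans L_le (leq_ltn_trans (leq_addr h _) HB).
- by [].
- by rewrite lvlE.
rewrite lvlE sg4 => okc cE.
apply: wp_seq; apply: wp_setreg => //.
move=> st5 sm5; rewrite cE => c5; apply: finish c5 _.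
  exact: same_trans sm4 (same_sub _ _ sm5).
have [cmp_sg _] := cmp _ sg_le.
apply: lookup_valid snd_ cmp_sg D0 sgD L_le => //; first exact: slE.
by move=> e eE le_h; rewrite mem_sl; apply: (mem_usable es_list).
Qed.

End Assembly.

(** * Word size and running time *)

Section Bounds.
Context {R : realType} {n : nat}.
Notation edge := ('I_n * 'I_n)%type.

(** From [ln (1 + x) <= x] at [x = - 1/2]. It trades binary logarithms for natural ones at the price
    of a factor 2. *)
Lemma half_le_ln2 : 1 <= 2%:R * ln (2%:R : R).
Proof.
have : ln (1 + - 2%:R^-1 : R) <= - 2%:R^-1 by apply: le_ln1Dx; lra.
have -> : 1 + - 2%:R^-1 = 2%:R^-1 :> R by lra.
by rewrite lnV ?posrE //; lra.
Qed.

Lemma ln_nat_ge (k : nat) : (2 <= k)%N -> 1 <= 2%:R * ln (k%:R : R).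
Proof.
move=> k2; apply: le_trans half_le_ln2 _; rewrite ler_pM2l //.
by rewrite ler_ln ?posrE ?ltr0n ?ler_nat //; lia.
Qed.

(** The logarithm itself is at most [2 * c * ln n] because [1 <= 2 * ln 2]; the successor adds 1,
    which is at most [2 * ln n]. *)
Lemma trunc_log_ln (c k : nat) : (2 <= n)%N -> (0 < k)%N -> (k <= n ^ c)%N ->
  (trunc_log 2 k).+1%:R <= (2 * c + 2)%:R * ln (n%:R : R).
Proof.
move=> n2 k0 kc; have ln0 := ln_nat_ge n2.
have : ln ((2 ^ trunc_log 2 k)%:R : R) <= ln ((n ^ c)%:R).
  rewrite ler_ln ?posrE ?ltr0n ?expn_gt0 ?(ltnW n2) // ler_nat.
  exact: leq_trans (trunc_logP _ k0) kc.
have n0 : (0 : R) < n%:R by rewrite ltr0n; lia.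
rewrite !natrX !lnXn // -[leLHS]mulr_natl -[leRHS]mulr_natl => le1.
have : (trunc_log 2 k)%:R * 1 <= (trunc_log 2 k)%:R * (2 * ln 2) :> R.
  by rewrite ler_wpM2l // half_le_ln2.
rewrite mulr1 -natr1 natrD natrM; lra.
Qed.

(** Each of the six summands is at most [X], the power of [n] with exponent [3 * c + 4], and [8 * X]
    is at most [n ^ 3 * X]. *)
Lemma table_bound (c h Hn S m B : nat) : (2 <= n)%N -> (h <= n ^ c)%N ->
  (Hn <= 2 * n ^ (2 * c) + n ^ c)%N -> (S.+1 <= n ^ c)%N -> (m <= n * n)%N ->
  (n ^ (3 * c + 7) <= B)%N ->
  (S.+1 * n * Hn.+1 + Hn + h + h + m + 4 <= B)%N.
Proof.
move=> n2 hc Hc Sc mc; apply: leq_trans.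
have n0 : (0 < n)%N by lia.
have mono a b : (a <= b)%N -> (n ^ a <= n ^ b)%N by move=> ?; apply: leq_pexp2l.
have le2 : (Hn.+1 <= n ^ (2 * c + 2))%N.
  rewrite expnD; have := mono c (2 * c)%N; have : (1 <= n ^ (2 * c))%N by rewrite expn_gt0 n0.
  have : (4 <= n ^ 2)%N by rewrite -[4%N]/(2 ^ 2)%N leq_exp2r.
  set x := (n ^ (2 * c))%N in Hc *; set y := (n ^ c)%N in Hc *; set z := (n ^ 2)%N.
  move=> z4 x1 yx; have {}yx : (y <= x)%N by apply: yx; lia.
  apply: (@leq_trans (x * 4)); last by rewrite leq_mul2l z4 orbT.
  by lia.
pose X := (n ^ (3 * c + 4))%N.
have e1 : (S.+1 * n * Hn.+1 <= X)%N.
  apply: (@leq_trans (n ^ c * n * n ^ (2 * c + 2))); first by rewrite !leq_mul.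
  by rewrite -expnSr -expnD; apply: mono; lia.
have e2 : (Hn <= X)%N by apply: leq_trans (ltnW le2) (mono _ _ _); lia.
have e3 : (h <= X)%N by apply: leq_trans hc (mono _ _ _); lia.
have e4 : (m <= X)%N.
  by apply: leq_trans mc _; rewrite mulnn; apply: mono; lia.
have e5 : (4 <= X)%N.
  apply: (@leq_trans (2 ^ 2)) => //; apply: (@leq_trans (n ^ 2)).
    by rewrite leq_exp2r.
  by apply: mono; lia.
have e6 : (X * 8 <= n ^ (3 * c + 7))%N.
  have -> : (n ^ (3 * c + 7) = X * n ^ 3)%N by rewrite /X -expnD; congr (_ ^ _)%N; lia.
  by rewrite leq_mul2l -[8%N]/(2 ^ 3)%N leq_exp2r // n2 orbT.
by lia.
Qed.

Variables (E : {set edge}) (freq : edge -> nat) (h : nat) (es : seq edge).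
Hypothesis es_list : edge_listing E freq h es.
Hypothesis freq_gt0 : forall e, e \in E -> (0 < freq e)%N.
Notation us := (usable freq h es).
Notation Pi := (inv_pi_sum E freq : R).

Lemma size_listing : (size es <= n * n)%N.
Proof.
have [/perm_size -> _] := es_list; rewrite -cardE.
by apply: leq_trans (max_card _) _; rewrite card_prod card_ord.
Qed.

Lemma sum_usable (x : R) : 0 <= x ->
  \sum_(e <- us) x / (freq e)%:R <= x * Pi.
Proof.
move=> x0; have -> : x * Pi = \sum_(e <- es) x / (freq e)%:R.
  have [pes _] := es_list; rewrite (perm_big _ pes) /= big_enum /= mulr_sumr.
  by apply: eq_bigr.
rewrite -[X in _ <= \sum_(e <- X) _](cat_take_drop (find (fun e => h < freq e)%N es)).
rewrite big_cat /= lerDl sumr_ge0 // => e _.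
by rewrite divr_ge0.
Qed.

(** Each usable edge has [h / freq e >= 1], so passes over these edges fit into the time bound. *)
Lemma size_usable_le : (size us)%:R <= h%:R * Pi.
Proof.
apply: le_trans (sum_usable (ler0n _ h)).
rewrite -sum1_size natr_sum big_seq [leRHS]big_seq; apply: ler_sum => e eus.
rewrite ler_pdivlMr ?mul1r ?ler_nat ?(usable_le eus) //.
by rewrite ltr0n freq_gt0 // (usable_sub es_list eus).
Qed.

(** Since [freq e <= 2 * pow_period freq e], replacing frequencies by powers of two at most doubles
    the number of relaxations. *)
Lemma work_le (Hn : nat) :
  (work (buckets freq us (trunc_log 2 h).+1) (pow_period freq) Hn)%:R <= 2 * Hn%:R * Pi.
Proof.
rewrite /work sum_buckets => [|e eus]; last exact: usable_level eus.
apply: le_trans (sum_usable _); last by rewrite mulr_ge0.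
rewrite natr_sum big_seq [leRHS]big_seq; apply: ler_sum => e eus.
have f0 : (0 < freq e)%N by rewrite freq_gt0 // (usable_sub es_list eus).
rewrite ler_pdivlMr ?ltr0n // -!natrM ler_nat.
have lt_f : (freq e <= 2 * pow_period freq e)%N.
  by rewrite /pow_period -expnS ltnW // trunc_log_ltn.
apply: leq_trans (leq_mul (leqnn _) lt_f) _.
by rewrite mulnCA leq_mul2l leq_divM orbT.
Qed.

End Bounds.

(** The summands pay for sorting, for filling the scales, and for counting the edges with the fixed
    overhead. A factor [c] supplies a missing [1 / eps], by [1 <= c / eps]; in the last summand a
    factor 2 likewise supplies the logarithm. *)
Definition time_const (c so r si b : nat) : nat :=
  ((2 * c + 2) * ((so + 5) * c) +
   (2 * c + 2) * ((r + 4) * (2 * (2 + c)) + (si + 4) * c) +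
   (b + 8) * (2 * c))%N.

(** Read [x], [l], [y] as [h * Pi], [ln n], [1 / eps]; [m] counts usable edges, [a] sorting passes,
    [S] scales, and [W] is the work per scale. *)
Lemma cost_le (R : realType) (m a W S c so r si b : nat) (x l y : R) :
  1 <= 2%:R * l -> 1 <= c%:R * y -> 1 <= x -> m%:R <= x -> 0 <= y ->
  a%:R <= (2 * c + 2)%:R * l -> S%:R <= (2 * c + 2)%:R * l ->
  W%:R <= (2 * (2 + c))%:R * (x * y) ->
  (((m * 2).+1 + (b + ((a * (m * so + 5) + 2) +
     (S * ((r + 4) * W + si + 4) + 2))).+1)%N)%:R
    <= (time_const c so r si b)%:R * (x * l * y).
Proof.
move=> l1 cy1 x1 mx y0 al Sl Wxy.
have l0 : 0 <= l by lra.
have x0 : 0 <= x by lra.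
have [c0 so0 r0 si0 b0] : [/\ 0 <= c%:R :> R, 0 <= so%:R :> R, 0 <= r%:R :> R,
  0 <= si%:R :> R & 0 <= b%:R :> R] by split.
have t1 : a%:R * (m%:R * so%:R + 5) <= (2 * c + 2)%:R * l * (((so + 5)%:R * x) * (c%:R * y)) :> R.
  apply: ler_pM => //.
  apply: (@le_trans _ _ ((so + 5)%:R * x)); last first.
    by rewrite ler_peMr // mulr_ge0.
  rewrite natrD mulrDl lerD //; last by lra.
  by rewrite mulrC ler_wpM2l.
have t2 : S%:R * ((r + 4)%:R * W%:R + (si + 4)%:R) <=
    (2 * c + 2)%:R * l * (((r + 4) * (2 * (2 + c)) + (si + 4) * c)%:R * (x * y)) :> R.
  apply: ler_pM => //.
  rewrite [X in _ <= X * _]natrD mulrDl lerD //.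
    by rewrite natrM -mulrA ler_wpM2l.
  rewrite natrM -mulrA ler_peMr //.
  by rewrite mulrCA; apply: (le_trans x1); rewrite ler_peMr.
have t3 : (m * 2 + b + 6)%:R <= (b + 8)%:R * x * (2 * l * (c%:R * y)) :> R.
  apply: (@le_trans _ _ ((b + 8)%:R * x)).
    rewrite !natrD natrM mulrDl.
    have : b%:R <= b%:R * x by rewrite ler_peMr.
    lra.
  rewrite ler_peMr ?mulr_ge0 //.
  by apply: (le_trans l1); rewrite ler_peMr // mulr_ge0.
have natE : ((m * 2).+1 + (b + ((a * (m * so + 5) + 2) +
     (S * ((r + 4) * W + si + 4) + 2))).+1 =
  m * 2 + b + 6 + a * (m * so + 5) + S * ((r + 4) * W + (si + 4)))%N.
  by rewrite -(addnA _ si 4); move: (a * _)%N (S * _)%N => P U; clear; lia.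
have -> : (((m * 2).+1 + (b + ((a * (m * so + 5) + 2) +
     (S * ((r + 4) * W + si + 4) + 2))).+1)%N)%:R =
  (m * 2 + b + 6)%:R + a%:R * (m%:R * so%:R + 5) + S%:R * ((r + 4)%:R * W%:R + (si + 4)%:R) :> R.
  by rewrite natE !(natrD, natrM).
have -> : (time_const c so r si b)%:R * (x * l * y) =
  (b + 8)%:R * x * (2 * l * (c%:R * y)) + (2 * c + 2)%:R * l * (((so + 5)%:R * x) * (c%:R * y)) +
  (2 * c + 2)%:R * l * (((r + 4) * (2 * (2 + c)) + (si + 4) * c)%:R * (x * y)) :> R.
  by rewrite /time_const !natrD !natrM !natrD; ring.
by rewrite !lerD.
Qed.

Theorem theorem3p1 (R : realType) :
  exists preprocess query : cmd,
  forall c : nat, exists C : nat,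
  forall (n : nat) (E : {set 'I_n * 'I_n}) (ell d : 'I_n * 'I_n -> R)
    (freq : 'I_n * 'I_n -> nat) (es : seq ('I_n * 'I_n))
    (eps Dmin Dmax : R) (h : nat) (s : 'I_n),
  (2 <= n)%N ->
  (forall e, e \in E -> 0 <= ell e) ->
  (forall e, e \in E -> 0 <= d e) ->
  0 < eps -> eps <= c%:R -> eps^-1 <= n%:R ^+ c ->
  (forall e, e \in E -> (0 < freq e)%N) ->
  (pi_sum E freq <= n ^ c)%N ->
  (1 <= h <= pi_sum E freq)%N ->
  0 < Dmin -> Dmin <= Dmax -> Dmax / Dmin <= n%:R ^+ c ->
  edge_listing E freq h es ->
  exists (k : nat) (st : store R),
  [/\ exec (n ^ C)%N preprocess
        (input_store ell d freq es eps Dmin Dmax h s) k st,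
      k%:R <= C%:R *
        Num.max 1 (h%:R * inv_pi_sum E freq * ln n%:R / eps)
    & forall (t : 'I_n) (D : R), Dmin <= D <= Dmax ->
      exists (k' : nat) (st' : store R),
      [/\ exec (n ^ C)%N query (query_store st t D) k' st',
          (k' <= C)%N
        & valid_answer E ell d freq h eps s t D (answer st')]].
Proof.
exists preprocess, query => c.
pose K := time_const c sort_steps relax_steps (steps scale_init) bounds_steps.
(* One constant has to be the factor of the preprocessing time, the bound on query steps and the
   exponent of the word bound; 3 is the cost of the early exit. *)
exists (K + steps query + 3 + (3 * c + 7))%N.
set C := (K + _ + _ + _)%N.
have [K_C Q_C T_C B_C] : [/\ (K <= C)%N, (steps query <= C)%N, (3 <= C)%N & (3 * c + 7 <= C)%N].
  by rewrite /C; split; lia.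
move: C K_C Q_C T_C B_C => C K_C Q_C T_C B_C.
move=> n E ell d freq es eps Dmin Dmax h s n2 ell0 d0 eps0 eps_c eps_inv freq0 pi_c.
move=> /andP[h0 h_pi] Dmin0 Dmin_le ratio es_list.
have n0 : (0 < n)%N by apply: leq_trans n2.
have hc := leq_trans h_pi pi_c.
have ratio_c : (Num.truncn (Dmax / Dmin) <= n ^ c)%N.
  rewrite -(ler_nat R) natrX (le_trans _ ratio) // truncn_le.
  by rewrite divr_ge0 ?(ltW Dmin0) // (le_trans (ltW Dmin0)).
have ratio_gt0 : (0 < Num.truncn (Dmax / Dmin))%N.
  by rewrite truncn_gt0 ler_pdivlMr // mul1r.
have S_c : ((top_scale Dmin Dmax).+1 <= n ^ c)%N.
  apply: leq_trans ratio_c; apply: leq_trans (trunc_logP (isT : (1 < 2)%N) ratio_gt0).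
  exact: ltn_expl.
have epsV0 : 0 <= eps^-1 by rewrite invr_ge0 ltW.
have H_le : (num_levels eps h)%:R <= 2 * h%:R / eps + h%:R :> R.
  by rewrite natrD lerD2r truncn_le !mulr_ge0.
have H_c : (num_levels eps h <= 2 * n ^ (2 * c) + n ^ c)%N.
  rewrite /num_levels leq_add // -(ler_nat R).
  apply: (@le_trans _ _ (2 * h%:R / eps)); first by rewrite truncn_le !mulr_ge0.
  have -> : (n ^ (2 * c) = n ^ c * n ^ c)%N by rewrite mul2n -addnn expnD.
  rewrite !natrM -mulrA ler_wpM2l // ler_pM //.
    by rewrite ler_nat.
  by rewrite natrX.
have table_B := table_bound n2 hc H_c S_c (size_listing es_list) (leq_pexp2l n0 B_C).
have ratio_B : (Num.truncn (Dmax / Dmin) < n ^ C)%N.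
  by apply: leq_ltn_trans ratio_c _; rewrite ltn_exp2l //; lia.
have [k [st [ex k_le rdy]]] := run_preprocess ell s d0 freq0 eps0 Dmin0 h0 es_list table_B ratio_B.
exists k, st; split=> //; last first.
  move=> t D D_in.
  have [k' [st' [ex' k'_le va]]] :=
    run_query ell0 d0 freq0 eps0 Dmin0 h0 es_list table_B ratio_B t rdy D_in.
  by exists k', st'; split=> //; apply: leq_trans k'_le Q_C.
(* Without usable edges [h * Pi] may be below 1, and the 3 steps are paid by the 1 in the
   maximum. *)
case us_nil: (usable freq h es) k_le => [|e us'] k_le.
  apply: (@le_trans _ _ C%:R); first by rewrite ler_nat (leq_trans k_le).
  by rewrite ler_peMr // le_max lexx.
set G := h%:R * _ * _ / _.
have m_le := size_usable_le (R := R) es_list freq0.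
have x1 : 1 <= h%:R * inv_pi_sum E freq :> R.
  by apply: le_trans m_le; rewrite us_nil /= ler1n.
have l1 : 1 <= 2 * ln (n%:R : R) := ln_nat_ge n2.
have cy1 : 1 <= c%:R * eps^-1 by rewrite ler_pdivlMr // mul1r.
(* Here [eps <= c] absorbs the levels added for rounding: [h <= c * h / eps], so the number of
   levels is at most [(2 + c) * h / eps]. *)
have W_le : (work (buckets freq (usable freq h es) (trunc_log 2 h).+1) (pow_period freq)
    (num_levels eps h))%:R <= (2 * (2 + c))%:R * (h%:R * inv_pi_sum E freq * eps^-1) :> R.
  apply: le_trans (work_le es_list freq0 _) _.
  have -> : (2 * (2 + c))%:R * (h%:R * inv_pi_sum E freq * eps^-1) =
    2 * ((2 + c%:R) * h%:R * eps^-1) * inv_pi_sum E freq :> R.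
    by rewrite natrM natrD; ring.
  rewrite ler_wpM2r ?ler_wpM2l //; first by apply: sumr_ge0 => f _; rewrite invr_ge0.
  apply: (le_trans H_le).
  have -> : (2 + c%:R) * h%:R * eps^-1 = 2 * h%:R / eps + h%:R * (c%:R * eps^-1) :> R by ring.
  by rewrite lerD2l ler_peMr.
have a_le := trunc_log_ln (R := R) n2 h0 hc.
have S_le := trunc_log_ln (R := R) n2 ratio_gt0 ratio_c.
have G_le := cost_le sort_steps relax_steps (steps scale_init) bounds_steps
  l1 cy1 x1 m_le epsV0 a_le S_le W_le.
apply: (@le_trans _ _ (K%:R * G)).
  by apply: le_trans G_le; rewrite ler_nat.
have G0 : 0 <= G.
  by apply: mulr_ge0 epsV0; apply: mulr_ge0; [exact: le_trans x1|lra].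
by apply: ler_pM; rewrite ?ler0n ?ler_nat // le_max lexx orbT.
Qed.
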